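(* There exists a universal constant $C>0$ such that the following holds. Let $X,X_1,\dots,X_n$ be i.i.d. random variables with values in a measurable space $\mathcal{X}$ and let $\mathcal{F}$ be a class of symmetric real-valued kernels $f$ on $\mathcal{X}\times\mathcal{X}$ such that $\mathbb{E}f(X,x)=0$ for all $x$ and all $f\in\mathcal{F}$, $f(x,x)=0$ for all $x$ and all $f\in\mathcal F$, and $\sup_{f\in\mathcal{F}}\|f\|_\infty=F<\infty$. Let $$Z=\sup_{f\in\mathcal{F}}\Big|\sum_{i,j}f(X_i,X_j)\Big|.$$ Let $\epsilon_1,\dots,\epsilon_n$ be i.i.d. Rademacher random variables independent of $X_1,\dots,X_n$, and define $$Z_\epsilon=\sup_{f\in\mathcal{F}}\Big|\sum_{i,j}\epsilon_i\epsilon_jf(X_i,X_j)\Big|,\qquad U_\epsilon=\sup_{f\in\mathcal{F}}\ \sup_{\alpha\in\mathbb{R}^n:\|\alpha\|_2\le1}\sum_{i,j}\epsilon_i\alpha_jf(X_i,X_j),$$ $$M=\sup_{f\in\mathcal{F},\,k=1,\dots,n}\Big|\sum_{i=1}^n\epsilon_if(X_i,X_k)\Big|.$$ Then for all $n$ and all $q\ge2$, $$(\mathbb{E}Z^q)^{1/q}\le C\left(\mathbb{E}Z_\epsilon+q^{1/2}\,\mathbb{E}U_\epsilon+q(\mathbb{E}M+Fn)+q^{3/2}Fn^{1/2}+q^2F\right).$$ Also, for all $n$ and all $t>0$, $$\mathbb{P}\{Z>C\,\mathbb{E}Z_\epsilon+t\}\le\exp\left(-\frac1C\min\left(\Big(\frac{t}{\mathbb{E}U_\epsilon}\Big)^2,\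 \frac{t}{\mathbb{E}M+Fn},\ \Big(\frac{t}{F\sqrt n}\Big)^{2/3},\ \sqrt{\frac tF}\right)\right).$$
   Context: Sums $\sum_{i,j}$ range over $i,j\in\{1,\dots,n\}$. A kernel $f$ is symmetric if $f(x,y)=f(y,x)$. Rademacher variables take the values $\pm1$ with probability $1/2$ each. Quotients with zero denominator are read as $+\infty$. All suprema are assumed measurable. *)

(* Defs.v *)
From HB Require Import structures.
From mathcomp Require Import all_boot all_order all_algebra.
From mathcomp Require Import all_classical all_reals all_analysis.

Set Implicit Arguments.
Unset Strict Implicit.
Unset Printing Implicit Defensive.

Import Order.TTheory GRing.Theory Num.Theory.
Import numFieldNormedType.Exports.

Local Open Scope classical_set_scope.
Local Open Scope ring_scope.

Section probability_notions.
Context {d dS dS' : measure_display} {T : measurableType d} {R : realType}.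
Context {S : measurableType dS} {S' : measurableType dS'}.
Variable P : probability T R.

Definition mutually_independent (I : finType) (Y : I -> {RV P >-> S}) : Prop :=
  forall (J : {set I}) (A : I -> set S), (forall i, measurable (A i)) ->
    P (\bigcap_(i in [set` J]) (Y i @^-1` A i)) =
    (\prod_(i in J) P (Y i @^-1` A i))%E.

(* Laws are compared on measurable sets only: a probability is a function on
   all sets, with no meaning outside the sigma-algebra. *)
Definition identically_distributed (I : finType) (Y : I -> {RV P >-> S})
    : Prop :=
  forall (i j : I) (A : set S), measurable A ->
    distribution P (Y i) A = distribution P (Y j) A.

Definition iid (I : finType) (Y : I -> {RV P >-> S}) : Prop :=
  mutually_independent Y /\ identically_distributed Y.

Definition independent_elements (U : T -> S) (V : T -> S') : Prop :=
  forall (A : set S) (B : set S'), measurable A -> measurable B ->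
    P (U @^-1` A `&` V @^-1` B) = (P (U @^-1` A) * P (V @^-1` B))%E.

Definition rademacher (e : {RV P >-> R}) : Prop :=
  P (e @^-1` [set 1]) = (2^-1)%:E /\ P (e @^-1` [set -1]) = (2^-1)%:E.

Definition random_vector (n : nat) (Y : 'I_n -> {RV P >-> S}) (w : T)
    : n.-tuple S := [tuple Y i w | i < n].

End probability_notions.

Section kernels.
Context {R : realType} {S : Type}.
Implicit Types (f : S -> S -> R) (FF : set (S -> S -> R)).

(* Pointwise, not essential, supremum. *)
Definition supnorm f : \bar R :=
  ereal_sup [set `|f xy.1 xy.2|%:E | xy in [set: S * S]].

Definition l2norm (n : nat) (a : 'I_n -> R) : R :=
  Num.sqrt (\sum_(j < n) a j ^+ 2).

(* The suprema below are real-valued.  They are taken over sets that are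
   bounded above whenever the kernels of FF are uniformly bounded; the
   convention sup set0 = 0 is then only relevant for sup_M with n = 0 or for
   an empty FF. *)
Section suprema.
Variables (n : nat) (FF : set (S -> S -> R)).
Implicit Types (e : 'I_n -> R) (x : 'I_n -> S).

Definition sup_Z x : R :=
  sup [set `|\sum_(i < n) \sum_(j < n) f (x i) (x j)| | f in FF].

Definition sup_Zeps e x : R :=
  sup [set `|\sum_(i < n) \sum_(j < n) e i * e j * f (x i) (x j)| | f in FF].

Definition sup_Ueps e x : R :=
  sup [set sup [set \sum_(i < n) \sum_(j < n) e i * a j * f (x i) (x j)
               | a in [set a : 'I_n -> R | l2norm a <= 1]] | f in FF].

Definition sup_M e x : R :=
  sup [set `|\sum_(i < n) e i * f (x i) (x k)|
      | f in FF & k in [set: 'I_n]].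

End suprema.

End kernels.

(* Measurability is required on the product space S^n, for each fixed choice
   of signs.  Measurability of w |-> sup_Z FF (X w), etc. on the underlying
   probability space alone would be too weak: the law of such a variable need
   not be determined by the law of X. *)
Definition measurable_suprema {dS : measure_display} {R : realType}
    {S : measurableType dS} (n : nat) (FF : set (S -> S -> R)) : Prop :=
  measurable_fun [set: n.-tuple S] (fun x => sup_Z FF (tnth x)) /\
  forall e : 'I_n -> R, (forall i, e i = 1 \/ e i = -1) ->
    [/\ measurable_fun [set: n.-tuple S] (fun x => sup_Zeps FF e (tnth x)),
        measurable_fun [set: n.-tuple S] (fun x => sup_Ueps FF e (tnth x)) &
        measurable_fun [set: n.-tuple S] (fun x => sup_M FF e (tnth x))].

(* Main.v *)
Require Import Defs.
From HB Require Import structures.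
From mathcomp Require Import all_boot all_order all_algebra.
From mathcomp Require Import all_classical all_reals all_analysis.
From mathcomp Require Import measurable_realfun ring lra.

Set Implicit Arguments.
Unset Strict Implicit.
Unset Printing Implicit Defensive.

Import Order.TTheory GRing.Theory Num.Theory.
Import numFieldNormedType.Exports.

Local Open Scope classical_set_scope.
Local Open Scope ring_scope.

(** Write b = Fn, W = U^2 and let E_eps be the mean over the signs.  Since M <= b,
    it suffices to prove a mixed Gaussian/exponential bound with parameters E U
    and b.

    Expanding f(x_i, x_j) over an independent copy of the sample and over all
    choices eta of one of the two copies of each point gives, by degeneracy,
    Z(x) <= 4 avg_eta Q_eta(x), where Q_eta integrates out the points selected by
    eta in Zeps with signs (-1)^eta.  By Jensen's inequality,
    E exp(l Z) <= E exp(4 l Zeps).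

    For a nonnegative Y, Ent(exp(s Y)) <= k s^2 E[Y exp(s Y)] with k <= 1/4 implies
    E exp(Y) <= exp(2 E Y), by a dyadic form of the Herbst argument.  It is applied
    first conditionally on the sample to l Zeps + t W with t ~ l^2: flipping signs
    changes Zeps and W by amounts whose squares sum up to 16 W and 16 b^2 W.
    It is then applied to the conditional mean E_eps(l Zeps + t W) as a function
    of the sample: removing one point decreases E_eps Zeps and E_eps W by at most
    2b and 3b^2, and by 2 E_eps Zeps and 3 E_eps W in total.  Averaging over the
    signs first is what makes the removal of a point decrease both functions, and
    allows comparing with conditional means only, since the suprema over fewer
    than n points need not be measurable.  Finally E W <= C((E U)^2 + b^2) follows
    from the exponential moments of W. *)

(** * Means, entropy and the Herbst argument *)

(** The obstacle is that the variance proxy of Zeps under sign flips is the random quantity W, so an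
    entropy bound for l Zeps alone does not close. W is self-bounding up to the factor b^2, and
    adding t W absorbs both proxies: 32 (l^2 + t^2 b^2) W <= (t / 2) W once t is a large multiple of
    l^2 and t b^2 is small. The price is l b <= const, which is the exponential regime of the final
    bound. Halving the parameter replaces differentiation of the log-Laplace transform, so that only
    inequalities between means occur, and one argument for an abstract mean serves both the cube and
    the sample. Both conclusions weaken when the expectations of the sign-dependent suprema grow, so
    lower bounds for these suffice; this copes with the points where eps is not a sign vector and
    measurability is not at hand. Chernoff's bound is effective for t >= b only. As the tail bound
    carries no prefactor, smaller t are left to Markov's inequality and a large C. *)

Record function_class (R : realType) (T : Type) (ok : (T -> R) -> Prop) : Prop := {
  fc_cst : forall c, ok (fun=> c);
  fcD : forall f g, ok f -> ok g -> ok (fun x => f x + g x);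
  fcM : forall f g, ok f -> ok g -> ok (fun x => f x * g x);
  fc_expR : forall f, ok f -> ok (fun x => expR (f x));
  fc_ln : forall f d, ok f -> 0 < d -> (forall x, d <= f x) ->
    ok (fun x => ln (f x));
  fc_max : forall f, ok f -> ok (fun x => Num.max (f x) 0);
  fc_bounded : forall f, ok f -> exists M, forall x, `|f x| <= M }.

(** A positive normalized linear functional, with axioms that hold alike for the finite cube, the
    sample and each single coordinate of either. *)
Record mean (R : realType) (T : Type) (ok : (T -> R) -> Prop)
    (E : (T -> R) -> R) : Prop := {
  meanD : forall f g, ok f -> ok g -> E (fun x => f x + g x) = E f + E g;
  meanZ : forall c f, ok f -> E (fun x => c * f x) = c * E f;
  mean_le : forall f g, ok f -> ok g -> (forall x, f x <= g x) -> E f <= E g;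
  mean_cst : forall c, E (fun=> c) = c }.

Definition entropy (R : realType) (T : Type) (E : (T -> R) -> R) (f : T -> R) :=
  E (fun x => f x * ln (f x)) - E f * ln (E f).

(** The covariance of [h] and [exp h]. By Jensen's inequality it dominates the entropy of [exp h],
    and it contains no logarithm. *)
Definition exp_cov (R : realType) (T : Type) (E : (T -> R) -> R) (h : T -> R) :=
  E (fun x => h x * expR (h x)) - E h * E (fun x => expR (h x)).

Section mean_theory.
Context {R : realType} {T : Type} {ok : (T -> R) -> Prop} {E : (T -> R) -> R}.
Hypotheses (okP : function_class ok) (EP : mean ok E).

Lemma fcZ c f : ok f -> ok (fun x => c * f x).
Proof. by move=> okf; apply: (fcM okP) => //; exact: fc_cst. Qed.

Lemma fcB f g : ok f -> ok g -> ok (fun x => f x - g x).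
Proof.
move=> okf okg; have := fcD okP okf (fcZ (-1) okg).
by under eq_fun do rewrite mulN1r.
Qed.

Lemma fc_exp_scale c f : ok f -> ok (fun x => expR (c * f x)).
Proof. by move=> okf; apply: (fc_expR okP); exact: fcZ. Qed.

Lemma fc_sum (I : Type) (r : seq I) (f : I -> T -> R) :
  (forall i, ok (f i)) -> ok (fun x => \sum_(i <- r) f i x).
Proof.
move=> okf; elim: r => [|i r IH].
  by under eq_fun do rewrite big_nil; exact: fc_cst.
by under eq_fun do rewrite big_cons; exact: (fcD okP).
Qed.

Lemma meanB f g : ok f -> ok g -> E (fun x => f x - g x) = E f - E g.
Proof.
move=> okf okg; rewrite -mulN1r -(meanZ EP) //.
rewrite -(meanD EP) //; last exact: fcZ.
by congr E; apply/funext => x; rewrite mulN1r.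
Qed.

Lemma mean_sum (I : Type) (r : seq I) (f : I -> T -> R) :
  (forall i, ok (f i)) ->
  E (fun x => \sum_(i <- r) f i x) = \sum_(i <- r) E (f i).
Proof.
move=> okf; elim: r => [|i r IH].
  by under eq_fun do rewrite big_nil; rewrite big_nil (mean_cst EP).
under eq_fun do rewrite big_cons; rewrite big_cons.
by rewrite (meanD EP) ?IH//; exact: fc_sum.
Qed.

Lemma mean_ge_cst c f : ok f -> (forall x, c <= f x) -> c <= E f.
Proof.
by move=> okf cf; rewrite -(mean_cst EP c); apply: (mean_le EP) => //; exact: fc_cst.
Qed.

Lemma mean_le_cst c f : ok f -> (forall x, f x <= c) -> E f <= c.
Proof.
by move=> okf cf; rewrite -(mean_cst EP c); apply: (mean_le EP) => //; exact: fc_cst.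
Qed.

Lemma expR_bounded_below f : ok f ->
  exists2 d, 0 < d & forall x, d <= expR (f x).
Proof.
move=> /(fc_bounded okP)[M fM]; exists (expR (- M)); first exact: expR_gt0.
by move=> x; rewrite ler_expR; have := fM x; rewrite ler_norml => /andP[].
Qed.

Lemma mean_expR_gt0 f : ok f -> 0 < E (fun x => expR (f x)).
Proof.
move=> okf; have [d d0 df] := expR_bounded_below okf.
by apply: (lt_le_trans d0); apply: mean_ge_cst => //; exact: fc_expR.
Qed.

Lemma expR_mean_le f : ok f -> expR (E f) <= E (fun x => expR (f x)).
Proof.
move=> okf; set m := E f.
have <- : E (fun x => expR m * (1 + (f x - m))) = expR m.
  rewrite (meanZ EP); last first.
    by apply: (fcD okP); [exact: fc_cst|apply: fcB => //; exact: fc_cst].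
  rewrite (meanD EP); last 2 first.
  - exact: fc_cst.
  - by apply: fcB => //; exact: fc_cst.
  rewrite meanB //; last exact: fc_cst.
  by rewrite !(mean_cst EP) -/m; lra.
apply: (mean_le EP).
- apply: fcZ; apply: (fcD okP); first exact: fc_cst.
  by apply: fcB => //; exact: fc_cst.
- exact: fc_expR.
move=> x; have -> : f x = m + (f x - m) by lra.
rewrite expRD ler_pM2l ?expR_gt0//.
have -> : m + (f x - m) - m = f x - m by lra.
exact: expR_ge1Dx.
Qed.

Lemma mean_cst_fun f c : (forall x, f x = c) -> E f = c.
Proof. by move=> fc; rewrite -(mean_cst EP c); congr E; apply/funext. Qed.

Lemma mean_ge0 f : ok f -> (forall x, 0 <= f x) -> 0 <= E f.
Proof. exact: mean_ge_cst. Qed.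

Let L (Y : T -> R) (s : R) := ln (E (fun x => expR (s * Y x))).

(** This is Jensen's inequality for [exp (- s Y / 2)] under the mean tilted by [exp (s Y) / m]. The
    tangent to exp is taken at [- c], with [c] the tilted mean of [s / 2 * Y]. *)
Lemma log_mgf_half Y s : ok Y -> 0 <= s ->
  L Y s * E (fun x => expR (s * Y x)) <=
  L Y (s / 2) * E (fun x => expR (s * Y x)) +
    s / 2 * E (fun x => Y x * expR (s * Y x)).
Proof.
move=> okY s0; set m := E (fun x => expR (s * Y x)).
set d := E (fun x => Y x * expR (s * Y x)).
have okeY c : ok (fun x => expR (c * Y x)) by exact: fc_exp_scale.
have m0 : 0 < m by apply: mean_expR_gt0; exact: fcZ.
pose c := s / 2 * (d / m).
have H : expR (- c) * m <= E (fun x => expR (s / 2 * Y x)).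
  have -> : expR (- c) * m = E (fun x => expR (- c) *
     ((1 + c) * expR (s * Y x) - (s / 2) * (Y x * expR (s * Y x)))).
    rewrite (meanZ EP); last by apply: fcB; apply: fcZ => //; exact: (fcM okP).
    rewrite meanB; [|by apply: fcZ|by apply: fcZ => //; exact: (fcM okP)].
    rewrite !(meanZ EP)//; last exact: (fcM okP).
    by rewrite -/m -/d; congr (_ * _); rewrite /c; field; rewrite gt_eqF.
  apply: (mean_le EP) => //.
    by apply: fcZ; apply: fcB; apply: fcZ => //; exact: (fcM okP).
  move=> x; rewrite mulrA -mulrBl mulrA.
  have {2}-> : s / 2 * Y x = - c + (c - s / 2 * Y x) + s * Y x by lra.
  rewrite (expRD _ (s * Y x)) (expRD (- c)).
  rewrite ler_pM2r ?expR_gt0// ler_pM2l ?expR_gt0//.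
  have := expR_ge1Dx (c - s / 2 * Y x); lra.
have : ln (expR (- c) * m) <= L Y (s / 2).
  by rewrite ler_ln // posrE ?mulr_gt0 ?expR_gt0 //; apply: mean_expR_gt0; exact: fcZ.
rewrite lnM ?posrE ?expR_gt0// expRK -/(L Y s) => {}H.
have -> : s / 2 * d = c * m by rewrite /c; field; rewrite gt_eqF.
by rewrite -mulrDl ler_pM2r//; lra.
Qed.

Lemma log_mgf_ge0 Y s : ok Y -> (forall x, 0 <= Y x) -> 0 <= s -> 0 <= L Y s.
Proof.
move=> okY Y0 s0; apply: ln_ge0; apply: mean_ge_cst; first exact: fc_exp_scale.
by move=> x; rewrite -expR0 ler_expR mulr_ge0.
Qed.

(** Follows from [ln x <= x - 1] and [exp u <= 1 + u + 2 u^2] for [0 <= u <= 1/2]. It serves at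
    [s = 2^-m], to see that [2^m L(2^-m)] is at most the mean of [Y] in the limit. *)
Lemma log_mgf_le_small Y s M : ok Y -> (forall x, 0 <= Y x) ->
  (forall x, Y x <= M) -> 0 <= s -> s * M <= 2^-1 ->
  L Y s <= s * E Y + 2 * (s * M) ^+ 2.
Proof.
move=> okY Y0 YM s0 sM.
have okeY : ok (fun x => expR (s * Y x)) by exact: fc_exp_scale.
have : L Y s <= E (fun x => expR (s * Y x)) - 1.
  have := expR_ge1Dx (L Y s).
  by rewrite lnK ?posrE; [lra|apply: mean_expR_gt0; exact: fcZ].
move=> /le_trans; apply.
rewrite lerBlDr.
have -> : s * E Y + 2 * (s * M) ^+ 2 + 1 =
    E (fun x => s * Y x + (2 * (s * M) ^+ 2 + 1)).
  by rewrite (meanD EP) ?(meanZ EP)// ?(mean_cst EP) ?addrA//;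
     [exact: fcZ|exact: fc_cst].
apply: (mean_le EP) => //.
  by apply: (fcD okP); [exact: fcZ|exact: fc_cst].
move=> x; set u := s * Y x.
have u0 : 0 <= u by exact: mulr_ge0.
have uM : u <= s * M by exact: ler_wpM2l.
have : expR u <= 1 + u + 2 * u ^+ 2.
  have := expR_ge1Dx (- u); rewrite expRN => H.
  have e0 := expR_gt0 u.
  have K : (1 - u) * expR u <= 1.
    by rewrite -ler_pdivlMr// div1r.
  have u1 : 0 < 1 - u by lra.
  rewrite -(ler_pM2l u1); apply: (le_trans K); rewrite -subr_ge0.
  have -> : (1 - u) * (1 + u + 2 * u ^+ 2) - 1 = u ^+ 2 * (1 - 2 * u) by ring.
  by rewrite mulr_ge0 ?sqr_ge0//; lra.
have : u ^+ 2 <= (s * M) ^+ 2 by rewrite lerXn2r // nnegrE //; lra.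
lra.
Qed.

(** Eliminating the mean of [Y exp (s Y)] between the entropy bound and [log_mgf_half] bounds [L(s)]
    by a multiple of [L(s / 2)]. Letting [s] run through 1, 1/2, 1/4, ... gives
    [(1 - 2 k) L(1) <= E Y], and [k <= 1/4] gives the factor 2. *)
Lemma mgf_le_of_self_bounded Y M k : ok Y -> (forall x, 0 <= Y x) ->
  (forall x, Y x <= M) -> 0 <= k -> k <= 4^-1 ->
  (forall s, 0 < s -> s <= 1 ->
    entropy E (fun x => expR (s * Y x)) <=
    k * s ^+ 2 * E (fun x => Y x * expR (s * Y x))) ->
  E (fun x => expR (Y x)) <= expR (2 * E Y).
Proof.
move=> okY Y0 YM k0 k4 entY.
have step s : 0 < s -> s <= 1 ->
    L Y s * (1 - 2 * k * s) <= L Y (s / 2) * (2 - 2 * k * s).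
  move=> s0 s1; have := entY _ s0 s1; rewrite /entropy.
  under eq_fun do rewrite expRK mulrC -mulrA.
  rewrite (meanZ EP); last by apply: (fcM okP) => //; exact: fc_exp_scale.
  have := log_mgf_half okY (ltW s0).
  rewrite -/(L Y s).
  set m := E (fun x => expR (s * Y x)).
  set d := E (fun x => Y x * expR (s * Y x)) => H1 H2.
  have m0 : 0 < m by apply: mean_expR_gt0; exact: fcZ.
  have ks : k * s <= 4^-1.
    by apply: le_trans k4; rewrite -[leRHS]mulr1 ler_wpM2l.
  rewrite -(ler_pM2r m0).
  (* The entropy bound reads [(1 - k s) s d <= m L(s)], so after this multiplication the term in [d]
     is at most [m L(s) / 2]. *)
  have : (1 - k * s) * (L Y s * m) <=
         (1 - k * s) * (L Y (s / 2) * m + s / 2 * d).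
    by rewrite ler_wpM2l//; lra.
  have E2 : k * s ^+ 2 * d = k * s * (s * d) by ring.
  rewrite E2 in H2; nra.
(* At [s = 2^-m] the ratio of the two factors in [step] is [(2^(m+1) - 2 k) / (2^m - 2 k)], so the
   product telescopes. *)
have Lm m : L Y 1 * (1 - 2 * k) <= L Y (2 ^- m) * (2 ^+ m - 2 * k).
  elim: m => [|m]; first by rewrite !expr0 invr1.
  move=> /le_trans; apply.
  have p0 : 0 < 2 ^+ m :> R by rewrite exprn_gt0.
  have p1 : 1 <= 2 ^+ m :> R by rewrite exprn_ege1// ler1n.
  have := step (2 ^- m); rewrite invr_gt0 invf_le1// => /(_ p0 p1) H.
  rewrite -(@ler_pM2r _ (2 ^- m)) ?invr_gt0//.
  have e1 : (2 ^+ m - 2 * k) / 2 ^+ m = 1 - 2 * k * 2 ^- m.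
    by field; rewrite gt_eqF.
  have e2 : (2 ^+ m.+1 - 2 * k) / 2 ^+ m = 2 - 2 * k * 2 ^- m.
    by rewrite exprS; field; rewrite gt_eqF.
  rewrite -!mulrA e1 e2; apply: (le_trans H).
  by rewrite exprS invfM [2^-1 * _]mulrC.
have L0 : 0 <= L Y 1 by exact: log_mgf_ge0.
have EY0 : 0 <= E Y by exact: mean_ge0.
have LE : L Y 1 * (1 - 2 * k) <= E Y.
  rewrite leNgt; apply/negP => lt.
  pose dl := L Y 1 * (1 - 2 * k) - E Y.
  have dl0 : 0 < dl by rewrite /dl subr_gt0.
  have M2 : 0 <= 2 * M ^+ 2 / dl.
    by apply: divr_ge0; [apply: mulr_ge0 => //; exact: sqr_ge0|exact: ltW].
  (* The first summand makes [2^-m M <= 1/2], as [log_mgf_le_small] demands; the second makes the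
     error [2 M^2 2^-m] smaller than the gap [dl]. *)
  have [m lt2] : exists m, 2 * `|M| + 2 * M ^+ 2 / dl < 2 ^+ m.
    exists (Num.bound (2 * `|M| + 2 * M ^+ 2 / dl)).
    apply: (@lt_trans _ _ (Num.bound (2 * `|M| + 2 * M ^+ 2 / dl))%:R).
      apply: le_lt_trans (archi_boundP _) => //.
      by apply: addr_ge0 => //; exact: mulr_ge0.
    by rewrite -natrX ltr_nat ltn_expl.
  have p0 : 0 < 2 ^+ m :> R by rewrite exprn_gt0.
  have := Lm m.
  have Lm0 : 0 <= L Y (2 ^- m) by apply: log_mgf_ge0 => //; rewrite invr_ge0 ltW.
  have small : 2 ^- m * M <= 2^-1.
    rewrite mulrC ler_pdivrMr//.
    have := ler_norm M; have := normr_ge0 M; lra.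
  have := log_mgf_le_small okY Y0 YM _ small; rewrite invr_ge0 => /(_ (ltW p0)).
  rewrite -/(L Y _) -(ler_pM2r p0) mulrDl => H1 H2.
  have e1 : 2 ^- m * E Y * 2 ^+ m = E Y by field; rewrite gt_eqF.
  have e2 : 2 * (2 ^- m * M) ^+ 2 * 2 ^+ m = 2 * M ^+ 2 * 2 ^- m.
    by field; rewrite gt_eqF.
  rewrite e1 e2 in H1.
  have : 2 * M ^+ 2 * 2 ^- m < dl.
    rewrite ltr_pdivrMr// [dl * _]mulrC -ltr_pdivrMr//.
    have := normr_ge0 M; lra.
  have : 0 <= L Y (2 ^- m) * k by exact: mulr_ge0.
  rewrite /dl; nra.
have : L Y 1 <= 2 * E Y by nra.
rewrite /L; under eq_fun do rewrite mul1r.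
rewrite -ler_expR lnK// posrE; exact: mean_expR_gt0.
Qed.

End mean_theory.

(** * Tensorization of entropy *)

(** [Ek k] averages over coordinate [k], and [rel k] relates points of the same fibre, which differ
    at most in that coordinate. [pm_local] is monotonicity on one fibre; by [pm_fold], averaging
    over all coordinates in turn leaves the constant [E f]. *)
Record product_mean (R : realType) (T : Type) (I : finType)
    (ok : (T -> R) -> Prop) (E : (T -> R) -> R)
    (Ek : I -> (T -> R) -> T -> R) (rel : I -> T -> T -> Prop) : Prop := {
  pm_mean : forall k x, mean ok (fun f => Ek k f x);
  pm_ok : forall k f, ok f -> ok (Ek k f);
  pm_local : forall k f g x, ok f -> ok g ->
    (forall y, rel k x y -> f y <= g y) -> Ek k f x <= Ek k g x;
  pm_inv : forall k f x y, rel k x y -> Ek k f x = Ek k f y;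
  pm_E : forall k f, ok f -> E (Ek k f) = E f;
  pm_fold : forall f x, ok f -> foldr Ek f (index_enum I) x = E f }.

Lemma ler_xlnx (R : realType) (u v : R) : 0 < u -> 0 < v ->
  u - v <= u * (ln u - ln v).
Proof.
move=> u0 v0; have := expR_ge1Dx (ln v - ln u).
rewrite expRD expRN !lnK ?posrE// => H.
have : u * (1 + (ln v - ln u)) <= u * (v / u) by rewrite ler_pM2l.
have -> : u * (v / u) = v by field; rewrite gt_eqF.
lra.
Qed.

Section tensorization.
Context {R : realType} {T : Type} {I : finType} {ok : (T -> R) -> Prop}.
Context {E : (T -> R) -> R} {Ek : I -> (T -> R) -> T -> R}.
Context {rel : I -> T -> T -> Prop}.
Hypotheses (okP : function_class ok) (EP : mean ok E).
Hypothesis pmP : product_mean ok E Ek rel.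

(** Rescale [h] to [v = (a / m) h], of the same fibre mean as [u = g], and average the pointwise
    inequality [u - v <= u (ln u - ln v)]: the difference [u - v] averages to 0. This is the Gibbs
    variational principle on one fibre. *)
Lemma gibbs_coordinate k g h d d' x : ok g -> ok h -> 0 < d -> 0 < d' ->
  (forall y, d <= g y) -> (forall y, d' <= h y) ->
  Ek k (fun y => g y * ln (h y)) x - Ek k (fun y => g y * ln (Ek k h y)) x <=
  entropy (fun f => Ek k f x) g.
Proof.
move=> okg okh d0 d'0 dg dh; have Mk := pm_mean pmP k x.
set a := Ek k g x; set m := Ek k h x.
have a0 : 0 < a by apply: (lt_le_trans d0); exact: (mean_ge_cst okP Mk).
have m0 : 0 < m by apply: (lt_le_trans d'0); exact: (mean_ge_cst okP Mk).
have okgh : ok (fun y => g y * ln (h y)).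
  by apply: (fcM okP) => //; exact: (fc_ln okP okh d'0).
have okgg : ok (fun y => g y * ln (g y)).
  by apply: (fcM okP) => //; exact: (fc_ln okP okg d0).
have okgE : ok (fun y => g y * ln (Ek k h y)).
  apply: (fcM okP) => //; apply: (fc_ln okP (pm_ok pmP k okh) d'0) => y.
  exact: (mean_ge_cst okP (pm_mean pmP k y)).
have okZ := fcZ okP; have okB := fcB okP.
have : Ek k (fun y => (g y * ln (h y) - g y * ln (Ek k h y)) +
                      (g y - (a / m) * h y)) x <=
       Ek k (fun y => g y * ln (g y) - ln a * g y) x.
  apply: (pm_local pmP).
  - apply: (fcD okP); first exact: okB.
    by apply: okB => //; exact: okZ.
  - by apply: okB => //; exact: okZ.
  move=> y xy; rewrite -(pm_inv pmP h xy) -/m.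
  have gy : 0 < g y by exact: lt_le_trans (dg y).
  have hy : 0 < h y by exact: lt_le_trans (dh y).
  have := @ler_xlnx _ (g y) (a / m * h y) gy.
  rewrite !lnM ?posrE ?mulr_gt0 ?invr_gt0// lnV ?posrE// => /(_ isT); lra.
rewrite (meanD Mk); [|exact: okB|by apply: okB => //; exact: okZ].
rewrite !(meanB okP Mk)//; [|exact: okZ|exact: okZ].
rewrite !(meanZ Mk)// -/a -/m /entropy -/a.
have -> : a / m * m = a by field; rewrite gt_eqF.
lra.
Qed.

Let fc_entropy k g d : ok g -> 0 < d -> (forall y, d <= g y) ->
  ok (fun x => entropy (fun f => Ek k f x) g).
Proof.
move=> okg d0 dg; apply: (fcB okP).
  by apply: (pm_ok pmP); apply: (fcM okP) => //; exact: (fc_ln okP okg d0).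
apply: (fcM okP); first exact: (pm_ok pmP).
apply: (fc_ln okP (pm_ok pmP k okg) d0) => y.
exact: (mean_ge_cst okP (pm_mean pmP k y)).
Qed.

(** With F_s the average of [g] over the coordinates in [s], [ln g - ln (E g)] telescopes along the
    list of coordinates; [gibbs_coordinate] with [h = F_s] bounds each increment by a one-coordinate
    entropy of [g] itself. *)
Lemma entropy_tensorization g d : ok g -> 0 < d -> (forall y, d <= g y) ->
  entropy E g <= \sum_k E (fun x => entropy (fun f => Ek k f x) g).
Proof.
move=> okg d0 dg.
have okF s : ok (foldr Ek g s) by elim: s => //= k s; exact: (pm_ok pmP).
have dF s y : d <= foldr Ek g s y.
  by elim: s y => //= k s IH y; exact: (mean_ge_cst okP (pm_mean pmP k y)).
have okln f : ok f -> (forall y, d <= f y) -> ok (fun y => g y * ln (f y)).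
  by move=> okf df; apply: (fcM okP) => //; exact: (fc_ln okP okf d0).
suff H s : E (fun y => g y * ln (g y)) - E (fun y => g y * ln (foldr Ek g s y))
    <= \sum_(k <- s) E (fun x => entropy (fun f => Ek k f x) g).
  apply: le_trans (H _); rewrite /entropy lerD2l lerN2.
  under eq_fun do rewrite (pm_fold pmP)// mulrC.
  by rewrite (meanZ EP)// mulrC.
elim: s => [|k s IH]; first by rewrite big_nil subrr.
rewrite big_cons.
have H : E (fun y => g y * ln (foldr Ek g s y)) -
    E (fun y => g y * ln (foldr Ek g (k :: s) y)) <=
    E (fun x => entropy (fun f => Ek k f x) g).
  rewrite -(pm_E pmP k (okln _ (okF s) (dF s))).
  rewrite -(pm_E pmP k (okln _ (okF (k :: s)) (dF (k :: s)))).
  rewrite -(meanB okP EP); last 2 first.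
  - by apply: (pm_ok pmP); exact: okln.
  - exact: (pm_ok pmP k (okln _ (okF (k :: s)) (dF (k :: s)))).
  apply: (mean_le EP).
  - by apply: (fcB okP); apply: (pm_ok pmP); exact: okln.
  - exact: (fc_entropy _ _ d0 dg).
  by move=> x; exact: (gibbs_coordinate _ _ okg (okF s) d0 d0 dg (dF s)).
rewrite /= in H IH *; lra.
Qed.

(** Jensen's inequality on each fibre, [Ek h <= ln (Ek (exp h))], bounds each coordinate entropy by
    a covariance. *)
Lemma entropy_expR_le h : ok h ->
  entropy E (fun x => expR (h x)) <=
  \sum_k E (fun x => exp_cov (fun f => Ek k f x) h).
Proof.
move=> okh; have [d d0 dh] := expR_bounded_below okP okh.
have oke := fc_expR okP okh.
apply: le_trans (entropy_tensorization oke d0 dh) _.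
apply: ler_sum => k _; apply: (mean_le EP).
- exact: (fc_entropy _ oke d0 dh).
- apply: (fcB okP); first by apply: (pm_ok pmP); exact: (fcM okP).
  by apply: (fcM okP); exact: (pm_ok pmP).
move=> x; rewrite /entropy /exp_cov; have Mk := pm_mean pmP k x.
have m0 := mean_expR_gt0 okP Mk okh.
have := expR_mean_le okP Mk okh.
rewrite -[X in _ <= X](lnK (_ : _ \in Num.pos)) ?posrE// ler_expR => H.
under eq_fun do rewrite expRK mulrC.
rewrite lerD2l lerN2 mulrC; exact: (ler_wpM2l (ltW m0) H).
Qed.

End tensorization.

(** * The discrete cube *)

Section cube.
Context {R : realType} {I : finType}.
Implicit Types (b : {ffun I -> bool}) (g : {ffun I -> bool} -> R) (k : I).

Definition flip k b : {ffun I -> bool} := [ffun i => (i == k) (+) b i].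

Definition cube_mean g : R := (2 ^+ #|I|)^-1 * \sum_b g b.

Definition flip_mean k g b : R := 2^-1 * (g b + g (flip k b)).

Definition flip_rel k b b' : Prop := b' = b \/ b' = flip k b.

Lemma flipK k : involutive (flip k).
Proof. by move=> b; apply/ffunP => i; rewrite !ffunE addbA addbb. Qed.

Lemma flipC k j b : flip k (flip j b) = flip j (flip k b).
Proof. by apply/ffunP => i; rewrite !ffunE addbCA. Qed.

Lemma sum_flip k g : \sum_b g (flip k b) = \sum_b g b.
Proof. by rewrite [RHS](reindex_inj (inv_inj (flipK k))). Qed.

Lemma cube_mean_flip k g : cube_mean (fun b => g (flip k b)) = cube_mean g.
Proof. by rewrite /cube_mean sum_flip. Qed.

Let ok : ({ffun I -> bool} -> R) -> Prop := fun=> True.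

Lemma cube_function_class : function_class ok.
Proof.
split=> // f _; exists (\sum_b `|f b|) => b.
by rewrite (bigD1 b)//= lerDl sumr_ge0.
Qed.

Lemma cube_meanP : mean ok cube_mean.
Proof.
split.
- by move=> f g _ _; rewrite /cube_mean big_split mulrDr.
- by move=> c f _; rewrite /cube_mean -mulr_sumr mulrCA.
- move=> f g _ _ fg; rewrite /cube_mean ler_wpM2l ?invr_ge0 ?exprn_ge0//.
  exact: ler_sum.
- move=> c; rewrite /cube_mean big_const iter_addr_0 card_ffun card_bool.
  by rewrite -[c *+ _]mulr_natl natrX mulrA mulVf ?mul1r//.
Qed.

Lemma flip_meanP k b : mean ok (fun g => flip_mean k g b).
Proof.
rewrite /flip_mean; split.
- by move=> f g _ _; ring.
- by move=> c f _; ring.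
- by move=> f g _ _ fg; have := fg b; have := fg (flip k b); lra.
- by move=> c; field.
Qed.

Lemma flip_invariant_cst g : (forall k b, g (flip k b) = g b) ->
  forall b b', g b = g b'.
Proof.
move=> gk b b'.
pose c (s : seq I) : {ffun I -> bool} := [ffun i => if i \in s then b' i else b i].
have : forall s : seq I, g b = g (c s).
  elim=> [|k s ->]; first by congr g; apply/ffunP => i; rewrite ffunE.
  have [e|e] := eqVneq (c s k) (b' k).
    congr g; apply/ffunP => i; rewrite !ffunE inE.
    by case: eqP => //= ->; move: e; rewrite ffunE.
  rewrite -(gk k); congr g; apply/ffunP => i; rewrite [LHS]ffunE [RHS]ffunE inE.
  case: eqP => [->|] //=; last by rewrite ffunE.
  by case: (c s k) (b' k) e => [] [].
move=> /(_ (index_enum I)) ->; congr g; apply/ffunP => i.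
by rewrite ffunE mem_index_enum.
Qed.

Lemma cube_product_mean : product_mean ok cube_mean flip_mean flip_rel.
Proof.
split.
- exact: flip_meanP.
- by [].
- move=> k f g b _ _ fg; rewrite /flip_mean.
  have := fg b (or_introl erefl); have := fg (flip k b) (or_intror erefl); lra.
- move=> k f b b' [->//|->]; rewrite /flip_mean flipK; lra.
- move=> k g _; rewrite /flip_mean (meanZ cube_meanP)// (meanD cube_meanP)//.
  by rewrite cube_mean_flip; lra.
- move=> g b _.
  have E s : cube_mean (foldr flip_mean g s) = cube_mean g.
    elim: s => //= k s <-; rewrite /flip_mean (meanZ cube_meanP)//.
    by rewrite (meanD cube_meanP)// cube_mean_flip; lra.
  rewrite -(E (index_enum I)); apply/esym/(mean_cst_fun cube_meanP) => b'.
  (* [flip_mean k] makes its result invariant under [flip k], and the other flip means commute with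
     that flip. *)
  apply: flip_invariant_cst => k {b b'} b.
  have : k \in index_enum I by rewrite mem_index_enum.
  elim: (index_enum I) b => // j s IH b; rewrite inE /flip_mean /=.
  have [->|kj] /= := eqVneq k j; first by rewrite flipK addrC.
  by move=> ks; rewrite flipC !IH.
Qed.

(** On two points the covariance is [(u - v) (exp u - exp v) / 4], at most [(u - v)^2 / 4] times the
    larger exponential. Charging it to the larger value leaves only the positive part, so that only
    decreases under a flip have to be controlled. *)
Lemma exp_cov_flip k g b :
  exp_cov (fun f => flip_mean k f b) g <=
  flip_mean k (fun b => 2^-1 * Num.max (g b - g (flip k b)) 0 ^+ 2 * expR (g b)) b.
Proof.
rewrite /exp_cov /flip_mean flipK.
set u := g b; set v := g (flip k b).
have K (x y : R) : y <= x ->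
   (x - y) * (expR x - expR y) <= (x - y) ^+ 2 * expR x.
  move=> yx; rewrite expr2 -mulrA ler_wpM2l ?subr_ge0//.
  have := expR_ge1Dx (y - x); have := expR_gt0 x.
  have -> : expR y = expR x * expR (y - x) by rewrite -expRD; congr expR; ring.
  nra.
have [vu|uv] := leP v u.
  rewrite (max_l (_ : 0 <= u - v)) ?subr_ge0//.
  rewrite (max_r (_ : v - u <= 0)) ?subr_le0// expr0n/=.
  have := K _ _ vu; lra.
have {}uv := ltW uv.
rewrite (max_r (_ : u - v <= 0)) ?subr_le0// expr0n/=.
rewrite (max_l (_ : 0 <= v - u)) ?subr_ge0//.
have := K _ _ uv; lra.
Qed.

(** The factor 1/2 in [exp_cov_flip] makes [k = c / 2], whence the requirement [c <= 1/2]. *)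
Lemma cube_mgf_le (Y : {ffun I -> bool} -> R) (c : R) :
  (forall b, 0 <= Y b) -> 0 <= c -> c <= 2^-1 ->
  (forall b, \sum_k Num.max (Y b - Y (flip k b)) 0 ^+ 2 <= c * Y b) ->
  cube_mean (fun b => expR (Y b)) <= expR (2 * cube_mean Y).
Proof.
move=> Y0 c0 c2 Yc.
apply: (@mgf_le_of_self_bounded _ _ _ _ cube_function_class cube_meanP Y
  (\sum_b Y b) (c / 2)) => //.
- by move=> b; rewrite (bigD1 b)//= lerDl sumr_ge0.
- lra.
- lra.
move=> s s0 s1.
apply: le_trans (entropy_expR_le cube_function_class cube_meanP
  cube_product_mean _) _ => //.
pose D k b := 2^-1 * Num.max (s * Y b - s * Y (flip k b)) 0 ^+ 2 * expR (s * Y b).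
apply: (@le_trans _ _ (\sum_k cube_mean (D k))).
  apply: ler_sum => k _; rewrite -[leRHS](pm_E cube_product_mean k)//.
  by apply: (mean_le cube_meanP) => // b; exact: exp_cov_flip.
rewrite -(mean_sum cube_function_class cube_meanP)//.
rewrite -(meanZ cube_meanP)//; apply: (mean_le cube_meanP) => // b.
rewrite /D -mulr_suml mulrA ler_wpM2r ?expR_ge0//.
rewrite -mulr_sumr.
under eq_bigr do rewrite -mulrBr -[X in Num.max _ X](mulr0 s) -maxr_pMr ?(ltW s0)// exprMn.
rewrite -mulr_sumr.
have := Yc b; have := Y0 b; have : 0 <= s ^+ 2 by exact: sqr_ge0.
nra.
Qed.

End cube.

(** * Bounded measurable functions of an i.i.d. sample *)

Definition bounded_measurable (R : realType) d (T : measurableType d)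
    (g : T -> R) : Prop :=
  measurable_fun [set: T] g /\ exists M, forall x, `|g x| <= M.

Section bounded_measurable.
Context {R : realType} {d : measure_display} {T : measurableType d}.
Implicit Types g : T -> R.

Lemma bounded_measurable_class : function_class (@bounded_measurable R d T).
Proof.
split.
- by move=> c; split; [exact: measurable_cst|exists `|c|].
- move=> f g [mf [M fM]] [mg [N gN]]; split; first exact: measurable_funD.
  exists (M + N) => x; apply: (le_trans (ler_normD _ _)); exact: lerD.
- move=> f g [mf [M fM]] [mg [N gN]]; split; first exact: measurable_funM.
  by exists (M * N) => x; rewrite normrM; exact: ler_pM.
- move=> f [mf [M fM]]; split; first exact: measurableT_comp.
  exists (expR M) => x; rewrite ger0_norm ?expR_ge0// ler_expR.
  exact: le_trans (ler_norm _) (fM x).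
- move=> f c [mf [M fM]] c0 cf; split; first exact: measurableT_comp.
  exists (`|ln c| + `|ln M|) => x.
  have fx : 0 < f x by exact: lt_le_trans (cf x).
  have fM' : f x <= M by exact: le_trans (ler_norm _) (fM x).
  have : ln c <= ln (f x) by rewrite ler_ln ?posrE.
  have : ln (f x) <= ln M by rewrite ler_ln ?posrE// (lt_le_trans fx).
  have := ler_norm (ln M); have := ler_norm (- ln c); rewrite normrN.
  have := normr_ge0 (ln M); have := normr_ge0 (ln c).
  by rewrite ler_norml => *; apply/andP; split; lra.
- move=> f [mf [M fM]]; split; first exact: measurable_maxr.
  exists M => x; apply: le_trans (fM x).
  by rewrite /Num.max; case: ltP => // _; rewrite normr0.
- by move=> f [].
Qed.

Variable P : probability T R.

Lemma bounded_measurable_integrable g : bounded_measurable g ->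
  P.-integrable [set: T] (EFin \o g).
Proof.
move=> [mg [M gM]]; apply: measurable_bounded_integrable => //.
  by rewrite [X in (X < _)%E](@probability_setT _ _ _ P) ltry.
exists M; split; first by rewrite num_real.
by move=> N MN x _; apply: (le_trans (gM x)); exact: ltW.
Qed.

Lemma EFin_Rintegral g : bounded_measurable g ->
  (\int[P]_x g x)%:E = (\int[P]_x (g x)%:E)%E.
Proof.
move=> /bounded_measurable_integrable ig; rewrite /Rintegral fineK//.
exact: integrable_fin_num.
Qed.

Lemma Rintegral_mean : mean (@bounded_measurable R d T) (fun g => \int[P]_x g x).
Proof.
split.
- move=> f g bf bg; rewrite RintegralD//; exact: bounded_measurable_integrable.
- move=> c f bf; rewrite RintegralZl//; exact: bounded_measurable_integrable.
- move=> f g bf bg fg; apply: le_Rintegral => //;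
    exact: bounded_measurable_integrable.
- by move=> c; rewrite Rintegral_cst//= (@probability_setT _ _ _ P) mulr1.
Qed.

(** Gives access to Tonelli's theorem, which is applied to nonnegative functions, by adding a
    constant that is cancelled afterwards. *)
Lemma shift_nonneg g : bounded_measurable g ->
  exists M, bounded_measurable (fun x => g x + M) /\ forall x, 0 <= g x + M.
Proof.
move=> bg; have [mg [M gM]] := bg; exists M; split.
  apply: (fcD bounded_measurable_class) => //.
  exact: (fc_cst bounded_measurable_class).
by move=> x; have := gM x; rewrite ler_norml => /andP[]; lra.
Qed.

End bounded_measurable.

(** * Modifying one coordinate of a sample *)

Section update.
Context {dS : measure_display} {S : measurableType dS} {n : nat}.

Definition upd (k : 'I_n) (x : n.-tuple S) (s : S) : n.-tuple S :=
  [tuple if i == k then s else tnth x i | i < n].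

Definition agree_off (k : 'I_n) (x y : n.-tuple S) : Prop :=
  forall i, i != k -> tnth x i = tnth y i.

Lemma tnth_upd k x s i : tnth (upd k x s) i = if i == k then s else tnth x i.
Proof. by rewrite tnth_mktuple. Qed.

Lemma agree_off_upd k x s : agree_off k x (upd k x s).
Proof. by move=> i ik; rewrite tnth_upd (negbTE ik). Qed.

Lemma upd_agree_off k x y s : agree_off k x y -> upd k x s = upd k y s.
Proof.
move=> xy; apply: eq_from_tnth => i; rewrite !tnth_upd.
by case: (boolP (i == k)) => // /xy.
Qed.

Lemma measurable_upd k :
  measurable_fun [set: n.-tuple S * S] (fun p => upd k p.1 p.2).
Proof.
apply/measurable_fun_tnthP => i.
rewrite (_ : _ \o _ = fun p => if i == k then p.2 else tnth p.1 i); last first.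
  by apply/funext => p /=; rewrite tnth_upd.
case: (i == k); first exact: measurable_snd.
exact: (measurableT_comp (measurable_tnth i) measurable_fst).
Qed.

Lemma agree_off_cst (R : Type) (g : n.-tuple S -> R) :
  (forall k x y, agree_off k x y -> g x = g y) -> forall x y, g x = g y.
Proof.
move=> gk x y.
pose c (s : seq 'I_n) : n.-tuple S :=
  [tuple if i \in s then tnth y i else tnth x i | i < n].
have : forall s : seq 'I_n, g x = g (c s).
  elim=> [|k s ->].
    by congr g; apply: eq_from_tnth => i; rewrite tnth_mktuple.
  apply: (gk k) => i ik; rewrite !tnth_mktuple inE (negbTE ik)//.
move=> /(_ (index_enum _)) ->; congr g; apply: eq_from_tnth => i.
by rewrite tnth_mktuple mem_index_enum.
Qed.

Lemma measurable_tuple_rect (A : 'I_n -> set S) : (forall i, measurable (A i)) ->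
  measurable [set x : n.-tuple S | forall i, A i (tnth x i)].
Proof.
move=> mA; rewrite (_ : [set x | _] = \bigcap_(i in [set: 'I_n])
    ((fun x : n.-tuple S => tnth x i) @^-1` A i)).
  apply: fin_bigcap_measurable => // i _; rewrite -[X in measurable X]setTI.
  exact: measurable_tnth.
by apply/seteqP; split => [x Ax i _|x Ax i]; exact: Ax.
Qed.

End update.

(** * Coordinate averages of a product law *)

Section iid_mean.
Context {R : realType} {dS : measure_display} {S : measurableType dS} {n : nat}.
Variables (mu : probability S R) (nu : probability (n.-tuple S) R).
Hypothesis nuE : forall A : 'I_n -> set S, (forall i, measurable (A i)) ->
  nu [set x | forall i, A i (tnth x i)] = (\prod_i mu (A i))%E.

Definition tuple_mean (g : n.-tuple S -> R) : R := \int[nu]_x g x.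

Definition coord_mean (k : 'I_n) (g : n.-tuple S -> R) (x : n.-tuple S) : R :=
  \int[mu]_s g (upd k x s).

Let rect : set (set (n.-tuple S)) := [set B | exists2 A : 'I_n -> set S,
  (forall i, measurable (A i)) & B = [set x | forall i, A i (tnth x i)]].

Let rectI : setI_closed rect.
Proof.
move=> _ _ [A mA ->] [B mB ->]; exists (fun i => A i `&` B i).
  by move=> i; exact: measurableI.
by apply/seteqP; split=> [x [Ax Bx] i|x AB]; [split|split=> i; case: (AB i)].
Qed.

Let rectT : rect setT.
Proof. by exists (fun=> setT) => //; apply/seteqP; split. Qed.

Let measurable_rect B : rect B -> measurable B.
Proof. by move=> [A mA ->]; exact: measurable_tuple_rect. Qed.

Let generated_rect : @measurable _ (n.-tuple S) = <<s rect >>.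
Proof.
apply/seteqP; split; last first.
  apply: smallest_sub; first exact: sigma_algebra_measurable.
  exact: measurable_rect.
apply: smallest_sub; first exact: smallest_sigma_algebra.
apply: subset_trans (@sub_gen_smallest _ _ _) => B.
rewrite -bigcup_seq => -[k _ [A mA <-]]; rewrite setTI.
exists (fun i => if i == k then A else setT); first by move=> i; case: ifP.
apply/seteqP; split => [x Ax i|x /(_ k)]; last by rewrite eqxx.
by case: eqP => // ->.
Qed.

Let resampling k : {mfun (n.-tuple S * S)%type >-> n.-tuple S} :=
  HB.pack (fun p : n.-tuple S * S => upd k p.1 p.2)
    (isMeasurableFun.Build _ _ _ _ _ (measurable_upd k)).

(** Both sides agree on measurable rectangles, a generating class stable under intersection:
    redrawing coordinate [k] frees the [k]-th side, and the independent draw supplies the factor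
    [mu (A k)]. This is the source of [pm_E]. *)
Lemma resampling_invariant k (B : set (n.-tuple S)) : measurable B ->
  nu B = distribution (nu \x mu)%E (resampling k) B.
Proof.
move=> mB.
apply: (@measure_unique _ _ _ rect (fun=> setT) generated_rect rectI
  (fun=> rectT)) => //.
- by rewrite bigcup_const//; exists 0%N.
- move=> _ [A mA ->]; apply: (eq_trans (nuE mA)).
  pose A' i := if i == k then setT else A i.
  have mA' i : measurable (A' i) by rewrite /A'; case: ifP.
  apply/esym; transitivity
      ((nu \x mu)%E ([set x | forall i, A' i (tnth x i)] `*` A k)).
    congr ((nu \x mu)%E _); apply/seteqP; split => [[x s]/= H|[x s]/= [H Ak] i].
      split=> [i|]; last by have := H k; rewrite tnth_upd eqxx.
      by have := H i; rewrite tnth_upd /A'; case: ifP.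
    by have := H i; rewrite tnth_upd /A'; case: eqP => // ->.
  rewrite product_measure1E//; last by apply: measurable_rect; exists A'.
  rewrite [X in (X * _)%E](nuE mA') (bigD1 k)//= [in RHS](bigD1 k)//= /A' eqxx.
  rewrite (@probability_setT _ _ _ mu) mul1e muleC; congr (_ * _)%E.
  by apply: eq_bigr => i /negbTE ->.
- by move=> _; rewrite -ge0_fin_numE//; exact: fin_num_measure.
Qed.

Lemma measurable_section k (g : n.-tuple S -> R) x : bounded_measurable g ->
  bounded_measurable (fun s => g (upd k x s)).
Proof.
move=> [mg [M gM]]; split; last by exists M.
apply: (measurableT_comp mg); apply/measurable_fun_tnthP => i.
rewrite (_ : _ \o _ = fun s => if i == k then s else tnth x i).
  by case: (i == k).
by apply/funext => s /=; rewrite tnth_upd.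
Qed.

Let measurable_joint k (g : n.-tuple S -> R) : measurable_fun setT g ->
  measurable_fun [set: n.-tuple S * S] (fun p => (g (upd k p.1 p.2))%:E).
Proof.
move=> mg; apply/measurable_EFinP.
exact: (measurableT_comp mg (measurable_upd k)).
Qed.

Lemma coord_mean_bounded_measurable k (g : n.-tuple S -> R) : bounded_measurable g ->
  bounded_measurable (coord_mean k g).
Proof.
move=> bg; have [mg [M gM]] := bg.
have bk x := measurable_section k x bg.
have mM := Rintegral_mean mu.
have BC := @bounded_measurable_class R _ S.
split; last first.
  exists M => x; rewrite ler_norml; apply/andP; split.
    apply: (mean_ge_cst BC mM) => // s.
    by have := gM (upd k x s); rewrite ler_norml => /andP[].
  apply: (mean_le_cst BC mM) => // s.
  by have := gM (upd k x s); rewrite ler_norml => /andP[].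
have [N [[mN _] N0]] := shift_nonneg bg.
have -> : coord_mean k g = fun x => fine (\int[mu]_s (g (upd k x s) + N)%:E) - N.
  apply/funext => x; rewrite -[fine _]/(Rintegral _ _ _) (meanD mM)//.
    by rewrite (mean_cst mM) addrK.
  exact: (fc_cst BC).
apply: measurable_funB; last exact: measurable_cst.
apply: measurableT_comp; first exact: fine_measurable.
exact: (measurable_fun_fubini_tonelli_F (m2 := mu)
  (fun p => (g (upd k p.1 p.2) + N)%:E) (measurable_joint k mN)
  (fun p => N0 _)).
Qed.

Lemma tuple_mean_coord k (g : n.-tuple S -> R) : bounded_measurable g ->
  tuple_mean (coord_mean k g) = tuple_mean g.
Proof.
move=> bg; have [N [bN N0]] := shift_nonneg bg.
have BC := @bounded_measurable_class R _ S.
have BCn := @bounded_measurable_class R _ (n.-tuple S).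
have mM := Rintegral_mean mu.
have mN := Rintegral_mean nu.
suff : tuple_mean (coord_mean k (fun x => g x + N)) = tuple_mean (fun x => g x + N).
  have -> : coord_mean k (fun x => g x + N) = fun x => coord_mean k g x + N.
    apply/funext => x; rewrite /coord_mean (meanD mM) ?(mean_cst mM)//.
      exact: measurable_section.
    exact: (fc_cst BC).
  rewrite /tuple_mean !(meanD mN) ?(mean_cst mN)//.
  - by move/addIr.
  - exact: (fc_cst BCn).
  - exact: coord_mean_bounded_measurable.
  - exact: (fc_cst BCn).
apply: (congr1 fine (_ : _%:E = _%:E)); rewrite !EFin_Rintegral//; last exact: coord_mean_bounded_measurable.
rewrite [RHS](eq_measure_integral (distribution (nu \x mu)%E (resampling k))); last first.
  by move=> A mA _; exact: resampling_invariant.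
rewrite ge0_integral_distribution//; last first.
  by apply/measurable_EFinP; case: bN.
rewrite fubini_tonelli1; last 2 first.
- by case: bN => mg _; exact: (measurable_joint k mg).
- by move=> p; rewrite lee_fin; exact: N0.
apply: eq_integral => x _; rewrite /coord_mean EFin_Rintegral//.
exact: (measurable_section k x bN).
Qed.

Lemma tuple_product_mean :
  product_mean (@bounded_measurable R _ (n.-tuple S)) tuple_mean coord_mean
    agree_off.
Proof.
have mM := Rintegral_mean mu.
have BC := @bounded_measurable_class R _ S.
split.
- move=> k x; rewrite /coord_mean; split.
  + by move=> f g bf bg; rewrite (meanD mM)//; exact: measurable_section.
  + by move=> c f bf; rewrite (meanZ mM)//; exact: measurable_section.
  + move=> f g bf bg fg; apply: (mean_le mM) => //; exact: measurable_section.
  + by move=> c; exact: (mean_cst mM).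
- exact: coord_mean_bounded_measurable.
- move=> k f g x bf bg fg; apply: (mean_le mM); [exact: measurable_section..|].
  by move=> s; apply: fg; exact: agree_off_upd.
- move=> k f x y xy; rewrite /coord_mean; congr Rintegral; apply/funext => s.
  by rewrite (upd_agree_off s xy).
- exact: tuple_mean_coord.
- move=> g x bg.
  have bF s : bounded_measurable (foldr coord_mean g s).
    by elim: s => //= k s; exact: coord_mean_bounded_measurable.
  have E s : tuple_mean (foldr coord_mean g s) = tuple_mean g.
    by elim: s => //= k s <-; exact: tuple_mean_coord.
  rewrite -(E (index_enum _)); apply/esym/(mean_cst_fun (Rintegral_mean nu)) => y.
  (* Averaging over [k] removes the dependence on coordinate [k], and averaging over further
     coordinates does not restore it. *)
  apply: agree_off_cst => k {x y} x y.
  have : k \in index_enum 'I_n by rewrite mem_index_enum.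
  elim: (index_enum 'I_n) x y => // j s IH x y; rewrite inE /coord_mean /=.
  have [<-|kj] /= := eqVneq k j.
    by move=> _ xy; congr Rintegral; apply/funext => t; rewrite (upd_agree_off t xy).
  move=> ks xy; congr Rintegral; apply/funext => t; apply: IH => // i ik.
  by rewrite !tnth_upd; case: ifP => // _; exact: xy.
Qed.

End iid_mean.

(** * Rademacher chaos of order two *)

Section chaos.
Context {R : realType} {n : nat}.
Implicit Types (A : 'I_n -> 'I_n -> R) (e : 'I_n -> R) (k : 'I_n) (c b F : R).

Definition chaos A e : R := \sum_i \sum_j e i * e j * A i j.

(** Half the partial derivative of [chaos] in the sign of index [j], for a symmetric matrix. *)
Definition chaos_lin A e (j : 'I_n) : R := \sum_i e i * A i j.

(** The square of the maximum of [\sum_j a j * chaos_lin A e j] over the unit ball; its supremum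
    over the class is [U^2]. *)
Definition chaos_sq A e : R := \sum_j chaos_lin A e j ^+ 2.

(* c = -1 flips the k-th sign and c = 0 removes the k-th point. *)
Definition scale_at k c e : 'I_n -> R := fun i => if i == k then c * e i else e i.

(** Deleting point [k] takes more than setting its sign to 0: the component [j = k] must go as well,
    since it still involves [x k]. *)
Definition chaos_sq_off k A e : R :=
  \sum_(j | j != k) chaos_lin A (scale_at k 0 e) j ^+ 2.

Definition kernel_matrix F A : Prop :=
  [/\ forall i j, A i j = A j i, forall i, A i i = 0 & forall i j, `|A i j| <= F].

Definition sign_vector e : Prop := forall i, `|e i| = 1.

Lemma chaosE A e : chaos A e = \sum_j e j * chaos_lin A e j.
Proof.
rewrite /chaos exchange_big; apply: eq_bigr => j _; rewrite mulr_sumr.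
by apply: eq_bigr => i _; ring.
Qed.

Lemma chaos_lin_scale A k c e j :
  chaos_lin A (scale_at k c e) j = chaos_lin A e j - (1 - c) * e k * A k j.
Proof.
rewrite /chaos_lin (bigD1 k)//= [X in _ = X - _](bigD1 k)//= /scale_at eqxx.
rewrite (eq_bigr (fun i => e i * A i j)); last by move=> i /negbTE ->.
ring.
Qed.

Section fixed_matrix.
Variables (A : 'I_n -> 'I_n -> R) (F : R).
Hypothesis AF : kernel_matrix F A.

Let Asym i j : A i j = A j i. Proof. by case: AF. Qed.
Let Adiag i : A i i = 0. Proof. by case: AF. Qed.
Let Abound i j : `|A i j| <= F. Proof. by case: AF. Qed.

(** By symmetry and the zero diagonal, the chaos is affine in each sign, with slope twice
    [chaos_lin]. *)
Lemma chaos_scale k c e :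
  chaos A (scale_at k c e) = chaos A e - 2 * (1 - c) * e k * chaos_lin A e k.
Proof.
rewrite !chaosE.
under eq_bigr do rewrite chaos_lin_scale mulrBr.
rewrite sumrB.
have -> : \sum_j scale_at k c e j * chaos_lin A e j =
    \sum_j e j * chaos_lin A e j - (1 - c) * e k * chaos_lin A e k.
  rewrite (bigD1 k)//= [X in _ = X - _](bigD1 k)//= /scale_at eqxx.
  rewrite (eq_bigr (fun i => e i * chaos_lin A e i)); last by move=> i /negbTE ->.
  ring.
have -> : \sum_j scale_at k c e j * ((1 - c) * e k * A k j) =
   (1 - c) * e k * chaos_lin A (scale_at k c e) k.
  by rewrite /chaos_lin mulr_sumr; apply: eq_bigr => j _; rewrite (Asym k); ring.
rewrite chaos_lin_scale Adiag; ring.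
Qed.

Section signs.
Variable e : 'I_n -> R.
Hypothesis e1 : sign_vector e.

Let b : R := F * n%:R.

Let e_sq k : e k ^+ 2 = 1.
Proof. by rewrite -real_normK ?num_real// e1 expr1n. Qed.

Lemma norm_chaos_lin_le k : `|chaos_lin A e k| <= b.
Proof.
apply: le_trans (ler_norm_sum _ _ _) _.
apply: (@le_trans _ _ (\sum_(i < n) F)).
  by apply: ler_sum => i _; rewrite normrM e1 mul1r.
by rewrite sumr_const card_ord /b mulr_natr.
Qed.

Lemma norm_chaos_le : `|chaos A e| <= b * n%:R.
Proof.
rewrite chaosE; apply: le_trans (ler_norm_sum _ _ _) _.
apply: (@le_trans _ _ (\sum_(i < n) b)).
  by apply: ler_sum => i _; rewrite normrM e1 mul1r norm_chaos_lin_le.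
by rewrite sumr_const card_ord mulr_natr.
Qed.

Lemma chaos_sq_le : chaos_sq A e <= b ^+ 2 * n%:R.
Proof.
apply: (@le_trans _ _ (\sum_(i < n) b ^+ 2)).
  apply: ler_sum => i _; rewrite -[X in X <= _]real_normK ?num_real// lerXn2r ?nnegrE//.
    exact: le_trans (norm_chaos_lin_le i).
  exact: norm_chaos_lin_le.
by rewrite sumr_const card_ord mulr_natr.
Qed.

Lemma norm_chaos_scale k c : 0 <= 1 - c ->
  `|chaos A e| <= `|chaos A (scale_at k c e)| + 2 * (1 - c) * `|chaos_lin A e k|.
Proof.
move=> c1; rewrite chaos_scale.
set q := chaos A e; set l := chaos_lin A e k.
have -> : 2 * (1 - c) * `|l| = `|2 * (1 - c) * e k * l|.
  by rewrite !normrM e1 mulr1 (ger0_norm c1) ger0_norm.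
have := ler_normD (q - 2 * (1 - c) * e k * l) (2 * (1 - c) * e k * l).
by rewrite subrK.
Qed.

(** Expanding the squares gives the difference [4 e_k \sum_j A_kj l_j - 4 \sum_j A_kj^2], whose last
    term is nonpositive. *)
Lemma chaos_sq_flip k : chaos_sq A e <= chaos_sq A (scale_at k (-1) e) +
  4 * `|\sum_j A k j * chaos_lin A e j|.
Proof.
rewrite -lerBlDl /chaos_sq -sumrB.
apply: (@le_trans _ _ (4 * (e k * \sum_j A k j * chaos_lin A e j))); last first.
  rewrite ler_pM2l//; apply: le_trans (ler_norm _) _.
  by rewrite normrM e1 mul1r.
rewrite mulrA mulr_sumr; apply: ler_sum => j _.
rewrite chaos_lin_scale; have := e_sq k; have := sqr_ge0 (A k j).
set l := chaos_lin A e j; set a := A k j; set s := e k => a2 s2.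
rewrite -subr_ge0.
have -> : 4 * s * (a * l) - (l ^+ 2 - (l - (1 - -1) * s * a) ^+ 2) =
  4 * s ^+ 2 * a ^+ 2 by ring.
by rewrite s2 mulr1 mulr_ge0.
Qed.

Lemma sum_sqr_le (x : 'I_n -> R) :
  (\sum_j x j) ^+ 2 <= n%:R * \sum_j x j ^+ 2.
Proof.
have [n0|n0] := posnP n.
  rewrite big1 ?expr0n ?mulr_ge0 ?sumr_ge0// => [j _|j _]; first exact: sqr_ge0.
  by have := leq_ltn_trans (leq0n j) (ltn_ord j); rewrite [X in (_ < X)%N]n0.
set S := \sum_j x j.
have : 0 <= \sum_j (n%:R * x j - S) ^+ 2 by apply: sumr_ge0 => j _; exact: sqr_ge0.
have -> : \sum_j (n%:R * x j - S) ^+ 2 =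
    n%:R * (n%:R * \sum_j x j ^+ 2 - S ^+ 2).
  rewrite (eq_bigr (fun j => n%:R ^+ 2 * x j ^+ 2 - 2 * n%:R * S * x j + S ^+ 2)).
    rewrite big_split/= sumrB -!mulr_sumr sumr_const card_ord -mulr_natl -/S; ring.
  by move=> j _; ring.
by rewrite pmulr_rge0 ?ltr0n// subr_ge0.
Qed.

(** Cauchy-Schwarz in each row: the Hilbert-Schmidt norm of [A], hence its operator norm, is at most
    [F n]. *)
Lemma sum_sqr_mul_lin :
  \sum_k (\sum_j A k j * chaos_lin A e j) ^+ 2 <= b ^+ 2 * chaos_sq A e.
Proof.
apply: (@le_trans _ _ (\sum_(k < n) n%:R * (F ^+ 2 * chaos_sq A e))); last first.
  rewrite sumr_const card_ord -mulr_natr /b.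
  by rewrite le_eqVlt; apply/orP; left; apply/eqP; ring.
apply: ler_sum => k _; apply: (le_trans (sum_sqr_le _)).
rewrite ler_wpM2l// mulr_sumr; apply: ler_sum => j _.
rewrite exprMn ler_wpM2r ?sqr_ge0// -[X in X <= _]real_normK ?num_real// lerXn2r ?nnegrE//.
exact: le_trans (Abound k j).
Qed.

(** By affineness, the value at sign 0 is the midpoint of the values at [e] and at its flip. *)
Lemma chaos_remove_flip k :
  2 * `|chaos A (scale_at k 0 e)| <= `|chaos A e| + `|chaos A (scale_at k (-1) e)|.
Proof.
have -> : 2 * `|chaos A (scale_at k 0 e)| =
    `|chaos A e + chaos A (scale_at k (-1) e)|.
  rewrite -[X in X * _](@ger0_norm _ 2)// -normrM; congr `|_|.
  rewrite !chaos_scale; ring.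
exact: ler_normD.
Qed.

(** The same midpoint, combined with convexity of the square in each component [j != k]; component
    [k] on the right is nonnegative. *)
Lemma chaos_sq_off_flip k :
  2 * chaos_sq_off k A e <= chaos_sq A e + chaos_sq A (scale_at k (-1) e).
Proof.
rewrite /chaos_sq_off /chaos_sq -big_split mulr_sumr/=.
rewrite [leRHS](bigD1 k)//= -[leLHS]add0r; apply: lerD.
  by rewrite addr_ge0 ?sqr_ge0.
apply: ler_sum => j _; rewrite !chaos_lin_scale.
set l := chaos_lin A e j; set t := e k; set a := A k j.
rewrite -subr_ge0.
have -> : l ^+ 2 + (l - (1 - -1) * t * a) ^+ 2 - 2 * (l - (1 - 0) * t * a) ^+ 2 =
  2 * (t * a) ^+ 2 by ring.
by rewrite mulr_ge0// sqr_ge0.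
Qed.

(** A pair [i != j] is lost exactly when [k] is [i] or [j], so the reduced chaoses sum up to [n - 2]
    times the chaos. *)
Lemma sum_chaos_remove :
  n%:R * `|chaos A e| <= \sum_k `|chaos A (scale_at k 0 e)| + 2 * `|chaos A e|.
Proof.
have -> : n%:R * `|chaos A e| =
    `|\sum_k chaos A (scale_at k 0 e) + 2 * chaos A e|.
  rewrite -[X in X * _](@ger0_norm _ n%:R)// -normrM; congr `|_|.
  under eq_bigr do rewrite chaos_scale subr0 mulr1 -mulrA.
  by rewrite sumrB sumr_const card_ord -mulr_sumr -chaosE subrK mulr_natl.
apply: le_trans (ler_normD _ _) _; rewrite [X in _ + X]normrM (@ger0_norm _ 2)//.
by rewrite lerD2r; exact: ler_norm_sum.
Qed.

(** The loss totals one [chaos_sq] from the deleted components and two from the cross terms; the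
    squares [A_kj^2] have the favourable sign. *)
Lemma sum_chaos_sq_off :
  n%:R * chaos_sq A e <= \sum_k chaos_sq_off k A e + 3 * chaos_sq A e.
Proof.
have E k : chaos_sq_off k A e = chaos_sq A e - chaos_lin A e k ^+ 2
    - 2 * (\sum_j e k * A k j * chaos_lin A e j) + \sum_j A k j ^+ 2.
  rewrite /chaos_sq_off /chaos_sq.
  transitivity (\sum_j chaos_lin A (scale_at k 0 e) j ^+ 2 - chaos_lin A e k ^+ 2).
    by rewrite [in RHS](bigD1 k)//= chaos_lin_scale Adiag mulr0 subr0 [X in _ = X - _]addrC addrK.
  have -> : \sum_j chaos_lin A (scale_at k 0 e) j ^+ 2 =
      \sum_j chaos_lin A e j ^+ 2
      - 2 * (\sum_j e k * A k j * chaos_lin A e j) + \sum_j A k j ^+ 2.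
    rewrite mulr_sumr -sumrB -big_split; apply: eq_bigr => j _ /=.
    rewrite chaos_lin_scale subr0 mul1r sqrrB exprMn e_sq; ring.
  ring.
under eq_bigr do rewrite E.
rewrite big_split/= !sumrB sumr_const card_ord -mulr_natl -mulr_sumr.
rewrite exchange_big/=.
have -> : \sum_(j < n) \sum_(i < n) e i * A i j * chaos_lin A e j = chaos_sq A e.
  by apply: eq_bigr => j _; rewrite -mulr_suml expr2.
rewrite -/(chaos_sq A e).
have : 0 <= \sum_(i < n) \sum_(j < n) A i j ^+ 2.
  by apply: sumr_ge0 => i _; apply: sumr_ge0 => j _; exact: sqr_ge0.
lra.
Qed.

(** The deleted component costs at most [b^2], and each other one at most [2 F b], in total
    [2 F n b = 2 b^2]. *)
Lemma chaos_sq_le_off k : chaos_sq A e <= chaos_sq_off k A e + 3 * b ^+ 2.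
Proof.
rewrite /chaos_sq /chaos_sq_off (bigD1 k)//= -lerBlDl.
have l2 j : chaos_lin A e j ^+ 2 <= b ^+ 2.
  rewrite -[X in X <= _]real_normK ?num_real// lerXn2r ?nnegrE//.
    exact: le_trans (norm_chaos_lin_le j).
  exact: norm_chaos_lin_le.
suff H : \sum_(j | j != k) chaos_lin A e j ^+ 2 -
    \sum_(j | j != k) chaos_lin A (scale_at k 0 e) j ^+ 2 <= 2 * b ^+ 2.
  by have := l2 k; lra.
rewrite -sumrB; apply: (@le_trans _ _ (\sum_(j < n) 2 * F * b)); last first.
  rewrite sumr_const card_ord -mulr_natr /b.
  by rewrite le_eqVlt; apply/orP; left; apply/eqP; ring.
rewrite [leRHS](bigID (fun j => j != k))/= -[leLHS]addr0; apply: lerD; last first.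
  have F0 : 0 <= F by apply: le_trans (Abound k k).
  by apply: sumr_ge0 => j _; rewrite !mulr_ge0.
apply: ler_sum => j _; rewrite chaos_lin_scale subr0 mul1r.
have : e k * A k j * chaos_lin A e j <= F * b.
  apply: le_trans (ler_norm _) _; rewrite !normrM e1 mul1r.
  by apply: ler_pM => //; exact: norm_chaos_lin_le.
rewrite sqrrB exprMn e_sq; have := sqr_ge0 (A k j); lra.
Qed.

End signs.
End fixed_matrix.
End chaos.

(** * Suprema over a class and Euclidean duality *)

Section family_sup.
Context {R : realType} {T : Type}.
Variable FF : set T.
Hypothesis FF0 : FF !=set0.
Implicit Types phi : T -> R.

Lemma image_sup_ub phi B f : (forall g, FF g -> phi g <= B) -> FF f ->
  phi f <= sup [set phi g | g in FF].
Proof.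
move=> phiB Ff; apply: ub_le_sup; last by exists f.
by exists B => _ [g Fg <-]; exact: phiB.
Qed.

Lemma image_sup_le phi c : (forall f, FF f -> phi f <= c) ->
  sup [set phi g | g in FF] <= c.
Proof.
have [f0 Ff0] := FF0; move=> phic; apply: ge_sup; first by exists (phi f0), f0.
by move=> _ [g Fg <-]; exact: phic.
Qed.

(** The case [m = 0] is included because [m] will be a sum of positive parts that may all vanish. *)
Lemma image_sup_mul_le phi m c : 0 <= m -> (forall f, FF f -> m * phi f <= c) ->
  m * sup [set phi g | g in FF] <= c.
Proof.
rewrite le_eqVlt => /orP[/eqP <-|m0 mc].
  by have [f0 Ff0] := FF0; move=> /(_ _ Ff0); rewrite !mul0r.
rewrite mulrC -ler_pdivlMr//; apply: image_sup_le => f Ff.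
by rewrite ler_pdivlMr// mulrC; exact: mc.
Qed.

End family_sup.

Lemma sup_unit_ball (R : realType) (n : nat) (l : 'I_n -> R) :
  sup [set \sum_j a j * l j | a in [set a : 'I_n -> R | l2norm a <= 1]] =
  Num.sqrt (\sum_j l j ^+ 2).
Proof.
set s := \sum_j l j ^+ 2; set r := Num.sqrt s.
have s0 : 0 <= s by apply: sumr_ge0 => j _; exact: sqr_ge0.
have rs : r ^+ 2 = s by rewrite sqr_sqrtr.
have r0 : 0 <= r by exact: sqrtr_ge0.
have ub (a : 'I_n -> R) : l2norm a <= 1 -> \sum_j a j * l j <= r.
  move=> a1; have a2 : \sum_j a j ^+ 2 <= 1.
    rewrite -[X in X <= _]sqr_sqrtr; last by apply: sumr_ge0 => j _; exact: sqr_ge0.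
    by rewrite -(expr1n _ 2) lerXn2r ?nnegrE// sqrtr_ge0.
  move: r0; rewrite le_eqVlt => /orP[/eqP r0|r0].
    rewrite big1 -?r0// => j _.
    have : s = 0 by rewrite -rs -r0 expr0n.
    move=> /eqP; rewrite psumr_eq0 => [/allP/(_ j)|i _]; last exact: sqr_ge0.
    by rewrite mem_index_enum sqrf_eq0 => /(_ isT)/eqP ->; rewrite mulr0.
  apply: (@le_trans _ _ (2^-1 * (r * \sum_j a j ^+ 2 + s / r))).
    rewrite /s mulr_sumr mulr_suml -big_split/= mulr_sumr.
    apply: ler_sum => j _; rewrite -subr_ge0.
    have -> : 2^-1 * (r * a j ^+ 2 + l j ^+ 2 / r) - a j * l j =
        (r * a j - l j) ^+ 2 / (2 * r) by field; rewrite gt_eqF.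
    by rewrite divr_ge0 ?sqr_ge0// mulr_ge0// ltW.
  have -> : s / r = r by rewrite -rs; field; rewrite gt_eqF.
  nra.
apply/eqP; rewrite eq_le; apply/andP; split.
  apply: ge_sup; last by move=> _ [a a1 <-]; exact: ub.
  exists 0, (fun=> 0); last by rewrite big1// => j _; rewrite mul0r.
  by rewrite /= /l2norm big1 ?sqrtr0// => j _; rewrite expr0n.
apply: ub_le_sup; first by exists r => _ [a a1 <-]; exact: ub.
have [->|rn0] := eqVneq r 0.
  exists (fun=> 0); last by rewrite big1// => j _; rewrite mul0r.
  by rewrite /= /l2norm big1 ?sqrtr0// => j _; rewrite expr0n.
exists (fun j => l j / r).
  rewrite /= /l2norm.
  under eq_bigr do rewrite exprMn exprVn.
  by rewrite -mulr_suml -/s -rs mulfV ?sqrf_eq0// sqrtr1.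
under eq_bigr do rewrite mulrAC -expr2.
by rewrite -mulr_suml -/s -rs; field.
Qed.

(** * Flipping a sign and removing a point in the suprema *)

Section sup_chaos.
Context {R : realType} {S : Type} {n : nat}.
Variables (FF : set (S -> S -> R)) (F : R).
Hypothesis FF0 : FF !=set0.
Hypothesis FFsym : forall f, FF f -> forall x y, f x y = f y x.
Hypothesis FFdiag : forall f, FF f -> forall x, f x x = 0.
Hypothesis FFbound : forall f, FF f -> forall x y, `|f x y| <= F.
Implicit Types (e : 'I_n -> R) (x : 'I_n -> S) (k : 'I_n).

Definition kernel_at (x : 'I_n -> S) (f : S -> S -> R) (i j : 'I_n) : R :=
  f (x i) (x j).

Definition sup_W e x : R := sup_Ueps FF e x ^+ 2.

Definition sup_W_off k e x : R :=
  sup [set chaos_sq_off k (kernel_at x f) e | f in FF].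

Local Notation b := (F * n%:R).

Lemma kernel_atP f x : FF f -> kernel_matrix F (kernel_at x f).
Proof.
by move=> Ff; split=> *; [exact: FFsym|exact: FFdiag|exact: FFbound].
Qed.

Lemma sign_flip k e : sign_vector e -> sign_vector (scale_at k (-1) e).
Proof. by move=> e1 i; rewrite /scale_at; case: eqP; rewrite ?mulN1r ?normrN. Qed.

Section fixed_signs.
Variables (e : 'I_n -> R) (x : 'I_n -> S).
Hypothesis e1 : sign_vector e.

Lemma chaos_le_sup f : FF f -> `|chaos (kernel_at x f) e| <= sup_Zeps FF e x.
Proof.
apply: (image_sup_ub (phi := fun f => `|chaos (kernel_at x f) e|)) => g Fg.
exact: (norm_chaos_le (kernel_atP x Fg) e1).
Qed.

Lemma sup_Zeps_ge0 : 0 <= sup_Zeps FF e x.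
Proof. by have [f Ff] := FF0; exact: le_trans (chaos_le_sup Ff). Qed.

Lemma sup_Zeps_le : sup_Zeps FF e x <= b * n%:R.
Proof.
by apply: image_sup_le => // f Ff; exact: (norm_chaos_le (kernel_atP x Ff) e1).
Qed.

Lemma chaos_remove_le_sup k f : FF f ->
  `|chaos (kernel_at x f) (scale_at k 0 e)| <= sup_Zeps FF (scale_at k 0 e) x.
Proof.
apply: (image_sup_ub (phi := fun f => `|chaos (kernel_at x f) (scale_at k 0 e)|)
  (B := b * n%:R)) => g Fg.
have := chaos_remove_flip (kernel_atP x Fg) e k.
have := norm_chaos_le (kernel_atP x Fg) e1.
have := norm_chaos_le (kernel_atP x Fg) (sign_flip k e1).
lra.
Qed.

Lemma sup_UepsE :
  sup_Ueps FF e x = sup [set Num.sqrt (chaos_sq (kernel_at x f) e) | f in FF].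
Proof.
rewrite /sup_Ueps; congr sup; apply/seteqP; split => _ [f Ff <-]; exists f => //;
  rewrite -(sup_unit_ball (chaos_lin (kernel_at x f) e)); congr sup;
  apply/seteqP; split => _ [a a1 <-]; exists a => //; rewrite exchange_big;
  apply: eq_bigr => j _; rewrite mulr_sumr; apply: eq_bigr => i _;
  rewrite /kernel_at; ring.
Qed.

Let chaos_sq_ge0 f : 0 <= chaos_sq (kernel_at x f) e.
Proof. by apply: sumr_ge0 => j _; exact: sqr_ge0. Qed.

Lemma sup_Ueps_ge_sqrt f : FF f ->
  Num.sqrt (chaos_sq (kernel_at x f) e) <= sup_Ueps FF e x.
Proof.
move=> Ff; rewrite sup_UepsE.
apply: (image_sup_ub (phi := fun f => Num.sqrt _) (B := Num.sqrt (b ^+ 2 * n%:R))) => //.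
move=> g Fg; apply: ler_wsqrtr.
exact: (chaos_sq_le (kernel_atP x Fg) e1).
Qed.

Lemma sup_Ueps_ge0 : 0 <= sup_Ueps FF e x.
Proof.
by have [f Ff] := FF0; apply: le_trans (sup_Ueps_ge_sqrt Ff); exact: sqrtr_ge0.
Qed.

Lemma chaos_sq_le_sup f : FF f -> chaos_sq (kernel_at x f) e <= sup_W e x.
Proof.
move=> Ff; rewrite -[leLHS]sqr_sqrtr// /sup_W.
by rewrite lerXn2r ?nnegrE ?sqrtr_ge0 ?sup_Ueps_ge0// sup_Ueps_ge_sqrt.
Qed.

Lemma sup_W_mul_le m c : 0 <= m ->
  (forall f, FF f -> m * chaos_sq (kernel_at x f) e <= c) -> m * sup_W e x <= c.
Proof.
rewrite le_eqVlt => /orP[/eqP <-|m0 mc].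
  by have [f0 Ff0] := FF0; move=> /(_ _ Ff0); rewrite !mul0r.
rewrite mulrC -ler_pdivlMr//.
have c0 : 0 <= c.
  by have [f Ff] := FF0; apply: le_trans (mc _ Ff); rewrite mulr_ge0// ltW.
rewrite -[leRHS]sqr_sqrtr ?divr_ge0 ?(ltW m0)//.
rewrite /sup_W lerXn2r ?nnegrE ?sqrtr_ge0 ?sup_Ueps_ge0//.
rewrite sup_UepsE; apply: image_sup_le => // f Ff; apply: ler_wsqrtr.
by rewrite ler_pdivlMr// mulrC mc.
Qed.

Lemma sup_W_ge0 : 0 <= sup_W e x. Proof. exact: sqr_ge0. Qed.

Lemma sup_W_le : sup_W e x <= b ^+ 2 * n%:R.
Proof.
rewrite -[leLHS]mul1r; apply: sup_W_mul_le => // f Ff; rewrite mul1r.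
exact: (chaos_sq_le (kernel_atP x Ff) e1).
Qed.

End fixed_signs.

Lemma chaos_sq_off_le_sup e x k f : sign_vector e -> FF f ->
  chaos_sq_off k (kernel_at x f) e <= sup_W_off k e x.
Proof.
move=> e1; apply: (image_sup_ub (phi := fun f => chaos_sq_off k (kernel_at x f) e)
   (B := b ^+ 2 * n%:R)) => g Fg.
have := chaos_sq_off_flip (kernel_at x g) e k.
have := chaos_sq_le (kernel_atP x Fg) e1.
have := chaos_sq_le (kernel_atP x Fg) (sign_flip k e1).
lra.
Qed.

Section inequalities.
Variables (e : 'I_n -> R) (x : 'I_n -> S).
Hypothesis e1 : sign_vector e.

Let Z := sup_Zeps FF e x.
Let Z' k := sup_Zeps FF (scale_at k (-1) e) x.
Let Z0 k := sup_Zeps FF (scale_at k 0 e) x.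
Let W := sup_W e x.
Let W' k := sup_W (scale_at k (-1) e) x.
Let W0 k := sup_W_off k e x.

Let amgm (B t : R) : 0 <= B -> B * (4 * t) <= B ^+ 2 / 2 + 8 * t ^+ 2.
Proof. by move=> B0; have := sqr_ge0 (B - 4 * t); rewrite sqrrB; lra. Qed.

Let maxE (a : R) : Num.max a 0 * a = Num.max a 0 ^+ 2.
Proof. by have [a0|a0] := leP a 0; rewrite ?mul0r ?expr0n ?expr2. Qed.

(** The supremum need not be attained, so no extremal kernel is fixed: each [|chaos|] is multiplied
    by [\sum_k B k] and bounded through [|chaos| <= Z' k + 4 |l_k|] before the supremum is taken.
    Then [4 B l <= B^2 / 2 + 8 l^2] and [B (Z - Z') = B^2] leave [\sum_k B k ^ 2 <= 16 W]. *)
Lemma sum_Z_flip : \sum_k Num.max (Z - Z' k) 0 ^+ 2 <= 16 * W.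
Proof.
set B := fun k => Num.max (Z - Z' k) 0.
have B0 k : 0 <= B k by rewrite /B le_max lexx orbT.
suff : (\sum_k B k) * Z <= \sum_k B k * Z' k + (\sum_k B k ^+ 2) / 2 + 8 * W.
  have -> : \sum_k B k ^+ 2 = (\sum_k B k) * Z - \sum_k B k * Z' k.
    rewrite mulr_suml -sumrB; apply: eq_bigr => k _.
    by rewrite -mulrBr -maxE.
  lra.
apply: image_sup_mul_le => // [|f Ff]; first exact: sumr_ge0.
apply: (@le_trans _ _ (\sum_k B k * Z' k + (\sum_k B k ^+ 2) / 2 +
    8 * chaos_sq (kernel_at x f) e)).
  rewrite mulr_suml /chaos_sq mulr_suml mulr_sumr -!big_split/=.
  apply: ler_sum => k _.
  have H : `|chaos (kernel_at x f) e| <=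
      Z' k + 4 * `|chaos_lin (kernel_at x f) e k|.
    have := norm_chaos_scale (kernel_atP x Ff) e1 k (_ : 0 <= 1 - -1).
    have := chaos_le_sup x (sign_flip k e1) Ff; rewrite -/(Z' k).
    by move=> ? /(_ _); lra.
  have := amgm `|chaos_lin (kernel_at x f) e k| (B0 k).
  have := ler_wpM2l (B0 k) H.
  rewrite real_normK ?num_real//; lra.
by rewrite lerD2l ler_pM2l//; exact: chaos_sq_le_sup.
Qed.

(** As for [sum_Z_flip], with the entries of [A l] in place of those of [l]; their squares sum up to
    at most [b^2 W]. *)
Lemma sum_W_flip : \sum_k Num.max (W - W' k) 0 ^+ 2 <= 16 * b ^+ 2 * W.
Proof.
set B := fun k => Num.max (W - W' k) 0.
have B0 k : 0 <= B k by rewrite /B le_max lexx orbT.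
suff : (\sum_k B k) * W <=
    \sum_k B k * W' k + (\sum_k B k ^+ 2) / 2 + 8 * (b ^+ 2 * W).
  have -> : \sum_k B k ^+ 2 = (\sum_k B k) * W - \sum_k B k * W' k.
    rewrite mulr_suml -sumrB; apply: eq_bigr => k _.
    by rewrite -mulrBr -maxE.
  lra.
apply: sup_W_mul_le => // [|f Ff]; first exact: sumr_ge0.
apply: (@le_trans _ _ (\sum_k B k * W' k + (\sum_k B k ^+ 2) / 2 +
    8 * (b ^+ 2 * chaos_sq (kernel_at x f) e))); last first.
  rewrite lerD2l ler_pM2l// ler_wpM2l ?sqr_ge0//; exact: chaos_sq_le_sup.
apply: (@le_trans _ _ (\sum_k B k * W' k + (\sum_k B k ^+ 2) / 2 +
    8 * \sum_k (\sum_j kernel_at x f k j * chaos_lin (kernel_at x f) e j) ^+ 2)); last first.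
  by rewrite lerD2l ler_pM2l//; exact: (sum_sqr_mul_lin (kernel_atP x Ff)).
rewrite mulr_suml mulr_suml mulr_sumr -!big_split/=.
apply: ler_sum => k _; set t := \sum_j _.
have H : chaos_sq (kernel_at x f) e <= W' k + 4 * `|t|.
  have := chaos_sq_flip (kernel_at x f) e1 k; rewrite -/t.
  by have := chaos_sq_le_sup x (sign_flip k e1) Ff; rewrite -/(W' k); lra.
have := amgm `|t| (B0 k).
have := ler_wpM2l (B0 k) H.
rewrite real_normK ?num_real//; lra.
Qed.

Lemma Z_remove_flip k : 2 * Z0 k <= Z + Z' k.
Proof.
apply: image_sup_mul_le => // f Ff.
apply: (le_trans (chaos_remove_flip (kernel_atP x Ff) e k)).
by apply: lerD; apply: chaos_le_sup => //; exact: sign_flip.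
Qed.

Lemma W_remove_flip k : 2 * W0 k <= W + W' k.
Proof.
apply: image_sup_mul_le => // f Ff.
apply: (le_trans (chaos_sq_off_flip (kernel_at x f) e k)).
by apply: lerD; apply: chaos_sq_le_sup => //; exact: sign_flip.
Qed.

Lemma sum_Z_remove : n%:R * Z <= \sum_k Z0 k + 2 * Z.
Proof.
apply: image_sup_mul_le => // f Ff.
apply: (le_trans (sum_chaos_remove (kernel_atP x Ff) e)).
apply: lerD; last by rewrite ler_pM2l//; exact: chaos_le_sup.
by apply: ler_sum => k _; exact: chaos_remove_le_sup.
Qed.

Lemma sum_W_remove : n%:R * W <= \sum_k W0 k + 3 * W.
Proof.
apply: sup_W_mul_le => // f Ff.
apply: (le_trans (sum_chaos_sq_off (kernel_atP x Ff) e1)).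
apply: lerD; last by rewrite ler_pM2l//; exact: chaos_sq_le_sup.
by apply: ler_sum => k _; exact: chaos_sq_off_le_sup.
Qed.

Lemma Z_le_remove k : Z <= Z0 k + 2 * b.
Proof.
apply: image_sup_le => // f Ff.
have := norm_chaos_scale (kernel_atP x Ff) e1 k (_ : 0 <= 1 - 0 :> R).
have := chaos_remove_le_sup x e1 k Ff; rewrite -/(Z0 k).
have := norm_chaos_lin_le (kernel_atP x Ff) e1 k.
by move=> ? ? /(_ _); lra.
Qed.

Lemma W_le_remove k : W <= W0 k + 3 * b ^+ 2.
Proof.
rewrite -[leLHS]mul1r; apply: sup_W_mul_le => // f Ff; rewrite mul1r.
apply: (le_trans (chaos_sq_le_off (kernel_atP x Ff) e1 k)).
by rewrite lerD2r; exact: chaos_sq_off_le_sup.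
Qed.

End inequalities.

Lemma sup_Zeps_remove_indep k e x y : (forall i, i != k -> x i = y i) ->
  sup_Zeps FF (scale_at k 0 e) x = sup_Zeps FF (scale_at k 0 e) y.
Proof.
move=> xy; rewrite /sup_Zeps; congr sup; apply: eq_imagel => f _; congr `|_|.
apply: eq_bigr => i _; apply: eq_bigr => j _; rewrite /scale_at.
have [->|ik] := eqVneq i k; first by rewrite !mul0r.
have [->|jk] := eqVneq j k; first by rewrite !mul0r !mulr0 !mul0r.
by rewrite !xy.
Qed.

Lemma sup_W_off_indep k e x y : (forall i, i != k -> x i = y i) ->
  sup_W_off k e x = sup_W_off k e y.
Proof.
move=> xy; rewrite /sup_W_off; congr sup; apply: eq_imagel => f _.
apply: eq_bigr => j jk; congr (_ ^+ 2).
apply: eq_bigr => i _; rewrite /scale_at /kernel_at.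
have [->|ik] := eqVneq i k; first by rewrite !mul0r.
by rewrite !xy.
Qed.

End sup_chaos.

(** * Exponential moments of the Rademacher chaos *)

Section self_bounding.
Context {R : realType} {T : Type} {I : finType} {ok : (T -> R) -> Prop}.
Context {E : (T -> R) -> R} {Ek : I -> (T -> R) -> T -> R}.
Context {rel : I -> T -> T -> Prop}.
Hypotheses (okP : function_class ok) (EP : mean ok E).
Hypothesis pmP : product_mean ok E Ek rel.

(** The term linear in [h - c] is kept because its fibre mean vanishes when [c] is the fibre mean of
    [h]. Below [c] it alone dominates the left-hand side, so that only the positive part of [h - c]
    survives averaging. *)
Lemma cov_expR_le (h c J : R) : c - J <= h -> h <= c + J -> 0 <= J ->
  (h - c) * (expR h - expR c) <=
  J * (2 * (Num.max (h - c) 0 * expR h) - expR c * (h - c)).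
Proof.
move=> h1 h2 J0.
have K (x y : R) : y <= x -> x - y <= J ->
   (x - y) * (expR x - expR y) <= J * ((x - y) * expR x).
  move=> yx xyJ; have := expR_ge1Dx (y - x); have e0 := expR_gt0 x.
  have -> : expR y = expR x * expR (y - x) by rewrite -expRD; congr expR; ring.
  move=> H; have H1 : expR x - expR x * expR (y - x) <= (x - y) * expR x by nra.
  apply: (@le_trans _ _ ((x - y) * ((x - y) * expR x))).
    by rewrite ler_wpM2l// subr_ge0.
  by rewrite ler_wpM2r// mulr_ge0 ?expR_ge0// subr_ge0.
have [ch|/ltW hc] := leP c h.
  rewrite (max_l (_ : 0 <= h - c)) ?subr_ge0//.
  have := K _ _ ch; have : expR c <= expR h by rewrite ler_expR.
  move=> ceh /(_ _)/le_trans; apply; first lra.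
  by rewrite ler_wpM2l// -subr_ge0; nra.
rewrite (max_r (_ : h - c <= 0)) ?subr_le0//.
have := K _ _ hc; move=> /(_ _); lra.
Qed.

(** [V k] depends on the other coordinates only, so on a fibre it acts as a constant, and a lack of
    measurability does no harm; it enters through [V k <= Ek k Y <= V k + J]. The constant [k = 6 J]
    is 2 from [cov_expR_le] times 3 from the sum of the decrements. *)
Lemma self_bounding_mgf (Y : T -> R) (V : I -> T -> R) (J : R) :
  ok Y -> (forall x, 0 <= Y x) ->
  (forall k x y, rel k x y -> V k x = V k y) ->
  (forall k x, V k x <= Y x) -> (forall k x, Y x <= V k x + J) ->
  (forall x, \sum_k (Y x - V k x) <= 3 * Y x) ->
  0 <= J -> J <= 24^-1 ->
  E (fun x => expR (Y x)) <= expR (2 * E Y).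
Proof.
move=> okY Y0 Vinv VY YV sumV J0 J24.
have [M YM] := fc_bounded okP okY.
apply: (mgf_le_of_self_bounded okP EP (M := M) (k := 6 * J)) => //.
- by move=> x; apply: le_trans (YM x); exact: ler_norm.
- exact: mulr_ge0.
- lra.
move=> s s0 s1; have okh := fcZ okP s okY.
set h := fun x => s * Y x.
have okeh : ok (fun x => expR (h x)) by exact: fc_expR.
have okE k : ok (Ek k h) by exact: (pm_ok pmP).
have EkE k x : Ek k h x = s * Ek k Y x by rewrite (meanZ (pm_mean pmP k x)).
have VE k x : V k x <= Ek k Y x.
  rewrite -[leLHS](mean_cst (pm_mean pmP k x)); apply: (pm_local pmP) => //.
    exact: fc_cst.
  by move=> y /Vinv ->.
have EV k x : Ek k Y x <= V k x + J.
  rewrite -[leRHS](mean_cst (pm_mean pmP k x)); apply: (pm_local pmP) => //.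
    exact: fc_cst.
  by move=> y /Vinv ->.
pose p k x := Num.max (h x - Ek k h x) 0 * expR (h x).
have okp k : ok (p k).
  apply: (fcM okP) => //; apply: (fc_max okP); exact: (fcB okP).
have covp k x : exp_cov (fun f => Ek k f x) h <= Ek k (fun y => s * J * 2 * p k y) x.
  have Mk := pm_mean pmP k x; set c := Ek k h x.
  have okhe : ok (fun y => h y * expR (h y)) by exact: fcM.
  have okcov : ok (fun y => (h y - c) * (expR (h y) - expR c)).
    by apply: (fcM okP); apply: (fcB okP) => //; exact: fc_cst.
  have [d dE] : exists d, d = c * expR c by eexists.
  have -> : exp_cov (fun f => Ek k f x) h =
      Ek k (fun y => (h y - c) * (expR (h y) - expR c)) x.
    rewrite (_ : (fun y => _) = (fun y => h y * expR (h y) +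
        ((- c) * expR (h y) + ((- expR c) * h y + d)))); last first.
      by apply/funext => y; rewrite dE; ring.
    rewrite (meanD Mk)//; last first.
      apply: (fcD okP); first exact: fcZ.
      by apply: (fcD okP); [exact: fcZ|exact: fc_cst].
    rewrite (meanD Mk); [|exact: fcZ|by apply: (fcD okP); [exact: fcZ|exact: fc_cst]].
    rewrite (meanD Mk); [|exact: fcZ|exact: fc_cst].
    rewrite !(meanZ Mk)// (mean_cst Mk) dE /exp_cov -EkE -/c; ring.
  pose r y := s * J * 2 * p k y + (- (s * J * expR c)) * (h y + - c).
  have okl : ok (fun y => h y + - c) by apply: (fcD okP) => //; exact: fc_cst.
  apply: (@le_trans _ _ (Ek k r x)); last first.
    rewrite (meanD Mk); [|exact: fcZ|exact: fcZ].
    rewrite [X in _ + X](meanZ Mk)// (meanD Mk)//; last exact: fc_cst.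
    by rewrite (mean_cst Mk) -/c subrr mulr0 addr0.
  apply: (pm_local pmP) => //.
    by apply: (fcD okP); exact: fcZ.
  move=> y xy; have cy : c = Ek k h y by exact: (pm_inv pmP).
  have sJ0 : 0 <= s * J by rewrite mulr_ge0// ltW.
  have h1 : c - s * J <= h y.
    rewrite cy EkE -mulrBr ler_pM2l//; have := EV k y; have := VY k y; lra.
  have h2 : h y <= c + s * J.
    rewrite cy EkE -mulrDr ler_pM2l//; have := VE k y; have := YV k y; lra.
  apply: (le_trans (cov_expR_le h1 h2 sJ0)).
  rewrite /r /p -cy; set u := Num.max _ _ * _; lra.
apply: (le_trans (entropy_expR_le okP EP pmP okh)).
apply: (@le_trans _ _ (\sum_k E (fun y => s * J * 2 * p k y))).
  apply: ler_sum => k _.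
  rewrite -[leRHS](pm_E pmP k); last exact: fcZ.
  apply: (mean_le EP) => [||x]; last exact: covp.
    apply: (fcB okP); first by apply: (pm_ok pmP); exact: fcM.
    by apply: (fcM okP) => //; exact: (pm_ok pmP).
  by apply: (pm_ok pmP); exact: fcZ.
rewrite -(mean_sum okP EP); last by move=> k; exact: fcZ.
rewrite -(meanZ EP); last exact: fcM.
apply: (mean_le EP).
- by apply: fc_sum => // k; exact: fcZ.
- by apply: fcZ => //; exact: fcM.
move=> x; rewrite -mulr_sumr /p -mulr_suml mulrA.
have : \sum_k Num.max (h x - Ek k h x) 0 <= s * (3 * Y x).
  apply: le_trans (_ : \sum_k s * (Y x - V k x) <= _).
    apply: ler_sum => k _; rewrite ge_max; apply/andP; split.
      by rewrite EkE -mulrBr ler_pM2l// lerD2l lerN2.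
    by rewrite mulr_ge0 ?(ltW s0)// subr_ge0.
  by rewrite -mulr_sumr ler_pM2l.
have e0 := expR_gt0 (h x).
move=> H; rewrite -[h x]/(s * Y x) -/(h x) mulrA ler_wpM2r ?(ltW e0)//.
have -> : 6 * J * s ^+ 2 * Y x = s * J * 2 * (s * (3 * Y x)) by ring.
by apply: ler_wpM2l => //; rewrite !mulr_ge0// ltW.
Qed.

End self_bounding.

Definition signs {R : realType} {n : nat} (b : {ffun 'I_n -> bool}) (i : 'I_n) : R :=
  (-1) ^+ b i.

Lemma signsP {R : realType} {n : nat} (b : {ffun 'I_n -> bool}) :
  sign_vector (signs b : 'I_n -> R).
Proof. by move=> i; rewrite /signs normrX normrN1 expr1n. Qed.

Lemma signs_flip {R : realType} {n : nat} k (b : {ffun 'I_n -> bool}) :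
  signs (flip k b) = scale_at k (-1) (signs b) :> ('I_n -> R).
Proof.
apply/funext => i; rewrite /signs /scale_at ffunE.
by case: eqP => _ /=; rewrite ?mulN1r; case: (b i); rewrite ?expr1 ?expr0 ?opprK.
Qed.

Lemma bounded_measurable_sup_Ueps {R : realType} {dS : measure_display}
    {S : measurableType dS} {n : nat} (FF : set (S -> S -> R)) (F : R) :
  FF !=set0 -> (forall f, FF f -> forall x y, f x y = f y x) ->
  (forall f, FF f -> forall x, f x x = 0) ->
  (forall f, FF f -> forall x y, `|f x y| <= F) ->
  forall b : {ffun 'I_n -> bool},
  measurable_fun [set: n.-tuple S] (fun x => sup_Ueps FF (signs b) (tnth x)) ->
  bounded_measurable (fun x : n.-tuple S => sup_Ueps FF (signs b) (tnth x)).
Proof.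
move=> FF0 FFsym FFdiag FFbound b mU; split=> //.
(* [v <= 1 + v^2], where [v^2] is bounded by [sup_W_le]. *)
exists (1 + (F * n%:R) ^+ 2 * n%:R) => x.
have := sup_W_le FF0 FFsym FFdiag FFbound (tnth x) (signsP b).
have := sup_Ueps_ge0 FF0 FFsym FFdiag FFbound (tnth x) (signsP b).
rewrite /sup_W; set v := sup_Ueps _ _ _ => v0; rewrite ger0_norm//.
by have := sqr_ge0 (1 - v); rewrite sqrrB; nra.
Qed.

Lemma bounded_measurable_sup_Zeps {R : realType} {dS : measure_display}
    {S : measurableType dS} {n : nat} (FF : set (S -> S -> R)) (F : R) :
  FF !=set0 -> (forall f, FF f -> forall x y, f x y = f y x) ->
  (forall f, FF f -> forall x, f x x = 0) ->
  (forall f, FF f -> forall x y, `|f x y| <= F) ->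
  forall b : {ffun 'I_n -> bool},
  measurable_fun [set: n.-tuple S] (fun x => sup_Zeps FF (signs b) (tnth x)) ->
  bounded_measurable (fun x : n.-tuple S => sup_Zeps FF (signs b) (tnth x)).
Proof.
move=> FF0 FFsym FFdiag FFbound b mZ; split=> //.
exists (F * n%:R * n%:R) => x.
rewrite ger0_norm ?(sup_Zeps_ge0 FF0 FFsym FFdiag FFbound _ (signsP b))//.
exact: (sup_Zeps_le FF0 FFsym FFdiag FFbound _ (signsP b)).
Qed.

Section chaos_mgf.
Context {R : realType} {dS : measure_display} {S : measurableType dS} {n : nat}.
Variables (mu : probability S R) (nu : probability (n.-tuple S) R).
Hypothesis nuE : forall A : 'I_n -> set S, (forall i, measurable (A i)) ->
  nu [set x | forall i, A i (tnth x i)] = (\prod_i mu (A i))%E.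
Variables (FF : set (S -> S -> R)) (F : R).
Hypothesis FF0 : FF !=set0.
Hypothesis FFsym : forall f, FF f -> forall x y, f x y = f y x.
Hypothesis FFdiag : forall f, FF f -> forall x, f x x = 0.
Hypothesis FFbound : forall f, FF f -> forall x y, `|f x y| <= F.

Let Zb (b : {ffun 'I_n -> bool}) (x : n.-tuple S) : R :=
  sup_Zeps FF (signs b) (tnth x).
Let Ub (b : {ffun 'I_n -> bool}) (x : n.-tuple S) : R :=
  sup_Ueps FF (signs b) (tnth x).
Let Wb (b : {ffun 'I_n -> bool}) (x : n.-tuple S) : R :=
  sup_W FF (signs b) (tnth x).

Hypothesis mZ : forall b, measurable_fun [set: n.-tuple S] (Zb b).
Hypothesis mU : forall b, measurable_fun [set: n.-tuple S] (Ub b).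

Definition joint_mean (g : {ffun 'I_n -> bool} -> n.-tuple S -> R) : R :=
  tuple_mean nu (fun x => cube_mean (g ^~ x)).

Local Notation c := (F * n%:R).
Let ok := @bounded_measurable R _ (n.-tuple S).
Let okP := @bounded_measurable_class R _ (n.-tuple S).
Let EP := Rintegral_mean nu : mean ok (tuple_mean nu).
Let CP := @cube_meanP R 'I_n.
Let CC := @cube_function_class R 'I_n.

Let okZ b : ok (Zb b).
Proof. exact: (bounded_measurable_sup_Zeps FF0 FFsym FFdiag FFbound (mZ b)). Qed.

Let okU b : ok (Ub b).
Proof. exact: (bounded_measurable_sup_Ueps FF0 FFsym FFdiag FFbound (mU b)). Qed.

Let okW b : ok (Wb b).
Proof.
rewrite /Wb /sup_W.
by under eq_fun do rewrite expr2; apply: (fcM okP); exact: okU.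
Qed.

Lemma cube_ok (g : {ffun 'I_n -> bool} -> n.-tuple S -> R) :
  (forall b, ok (g b)) -> ok (fun x => cube_mean (g ^~ x)).
Proof. by move=> okg; apply: (fcZ okP); exact: fc_sum. Qed.

Let G x := cube_mean (Zb ^~ x).
Let K x := cube_mean (Wb ^~ x).

Let okG : ok G. Proof. exact: cube_ok. Qed.
Let okK : ok K. Proof. exact: cube_ok. Qed.

Let Z0 b x : 0 <= Zb b x. Proof. exact: (sup_Zeps_ge0 FF0 FFsym FFdiag FFbound _ (signsP b)). Qed.
Let W0 b x : 0 <= Wb b x. Proof. exact: sup_W_ge0. Qed.

(** The hypothesis on [t] makes the sum self-bounding: the squared decrements of [l Zeps + t W] sum
    up to at most [32 (l^2 + t^2 c^2) W <= (t / 2) W]. *)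
Lemma rademacher_mgf l t x : 0 <= l -> 0 <= t ->
  64 * (l ^+ 2 + t ^+ 2 * c ^+ 2) <= t ->
  cube_mean (fun b => expR (l * Zb b x + t * Wb b x)) <=
  expR (2 * (l * G x + t * K x)).
Proof.
move=> l0 t0 lt.
have -> : l * G x + t * K x = cube_mean (fun b => l * Zb b x + t * Wb b x).
  by rewrite (meanD CP)// !(meanZ CP).
apply: (cube_mgf_le (c := 2^-1)) => //.
- by move=> b; rewrite addr_ge0// mulr_ge0.
move=> b; pose dZ k := Num.max (Zb b x - Zb (flip k b) x) 0.
pose dW k := Num.max (Wb b x - Wb (flip k b) x) 0.
apply: (@le_trans _ _ (\sum_k (2 * l ^+ 2 * dZ k ^+ 2 + 2 * t ^+ 2 * dW k ^+ 2))).
  apply: ler_sum => k _.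
  apply: (@le_trans _ _ ((l * dZ k + t * dW k) ^+ 2)).
    have z1 : Zb b x - Zb (flip k b) x <= dZ k by rewrite /dZ le_max lexx.
    have z0 : 0 <= dZ k by rewrite /dZ le_max lexx orbT.
    have w1 : Wb b x - Wb (flip k b) x <= dW k by rewrite /dW le_max lexx.
    have w0 : 0 <= dW k by rewrite /dW le_max lexx orbT.
    rewrite lerXn2r ?nnegrE ?le_max ?lexx ?orbT ?addr_ge0 ?mulr_ge0//.
    rewrite ge_max; apply/andP; split; last by rewrite addr_ge0 ?mulr_ge0.
    have := ler_wpM2l l0 z1; have := ler_wpM2l t0 w1; lra.
  have := sqr_ge0 (l * dZ k - t * dW k); rewrite sqrrB sqrrD; lra.
rewrite big_split/= -!mulr_sumr.
have := sum_Z_flip FF0 FFsym FFdiag FFbound (tnth x) (signsP b).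
have := sum_W_flip FF0 FFsym FFdiag FFbound (tnth x) (signsP b).
under eq_bigr do rewrite -signs_flip.
rewrite -/(\sum_k dW k ^+ 2) -/(Wb b x) => HW.
under eq_bigr do rewrite -signs_flip.
rewrite -/(\sum_k dZ k ^+ 2) => HZ.
have := ler_wpM2l (_ : 0 <= 2 * l ^+ 2) HZ; rewrite mulr_ge0 ?sqr_ge0// => /(_ isT).
have := ler_wpM2l (_ : 0 <= 2 * t ^+ 2) HW; rewrite mulr_ge0 ?sqr_ge0// => /(_ isT).
have := ler_wpM2r (W0 b x) lt; have := mulr_ge0 l0 (Z0 b x).
rewrite /dW /dZ; lra.
Qed.

Let Zr b k (x : n.-tuple S) : R := sup_Zeps FF (scale_at k 0 (signs b)) (tnth x).
Let Wr b k (x : n.-tuple S) : R := sup_W_off FF k (signs b) (tnth x).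

Lemma sample_mgf l t : 0 <= l -> 0 <= t -> 2 * l * c + 3 * t * c ^+ 2 <= 24^-1 ->
  tuple_mean nu (fun x => expR (l * G x + t * K x)) <=
  expR (2 * (l * tuple_mean nu G + t * tuple_mean nu K)).
Proof.
move=> l0 t0 J24.
have c0 : 0 <= c.
  have [->|n0] := eqVneq n 0%N; first by rewrite mulr0.
  have [f Ff] := FF0; have s : S by exact: point.
  by rewrite mulr_ge0//; apply: le_trans (FFbound Ff s s).
have -> : l * tuple_mean nu G + t * tuple_mean nu K =
    tuple_mean nu (fun x => l * G x + t * K x).
  by rewrite (meanD EP (fcZ okP l okG) (fcZ okP t okK)) (meanZ EP l okG) (meanZ EP t okK).
(* The sign average of the suprema with point [k] removed, a function of the other points. *)
pose V k x := cube_mean (fun b => l * Zr b k x + t * Wr b k x).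
have GK x : l * G x + t * K x = cube_mean (fun b => l * Zb b x + t * Wb b x).
  by rewrite (meanD CP)// !(meanZ CP).
apply: (self_bounding_mgf okP EP (tuple_product_mean nuE) (V := V)
  (J := 2 * l * c + 3 * t * c ^+ 2)) => //.
- by apply: (fcD okP); [exact: (fcZ okP _ okG)|exact: (fcZ okP _ okK)].
- move=> x; rewrite GK; apply: (mean_ge0 CC CP) => // b.
  by rewrite addr_ge0// mulr_ge0.
- move=> k x y xy; rewrite /V; congr cube_mean; apply/funext => b.
  by congr (_ * _ + _ * _); [apply: sup_Zeps_remove_indep|apply: sup_W_off_indep].
(* Pairing each sign vector with its flip replaces the sign mean by that of [flip_mean k], to which
   the midpoint inequalities apply. *)
- move=> k x; rewrite GK.
  rewrite -(pm_E cube_product_mean k (f := fun b => l * Zb b x + t * Wb b x))//.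
  apply: (mean_le CP) => // b; rewrite /flip_mean.
  have := Z_remove_flip FF0 FFsym FFdiag FFbound (tnth x) (signsP b) k.
  have := W_remove_flip FF0 FFsym FFdiag FFbound (tnth x) (signsP b) k.
  rewrite -!signs_flip -/(Zr b k x) -/(Wr b k x) -/(Zb b x) -/(Wb b x).
  rewrite -/(Zb (flip k b) x) -/(Wb (flip k b) x).
  move=> /(ler_wpM2l t0) + /(ler_wpM2l l0); lra.
- move=> k x; rewrite GK /V -[X in _ <= _ + X](mean_cst CP) -(meanD CP)//.
  apply: (mean_le CP) => // b.
  have := Z_le_remove FF0 FFsym FFdiag FFbound (tnth x) (signsP b) k.
  have := W_le_remove FF0 FFsym FFdiag FFbound (tnth x) (signsP b) k.
  rewrite -/(Zr b k x) -/(Wr b k x) -/(Zb b x) -/(Wb b x).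
  move=> /(ler_wpM2l t0) + /(ler_wpM2l l0); lra.
- move=> x; rewrite GK /V.
  under eq_bigr do rewrite -(meanB CC CP)//.
  rewrite -(mean_sum CC CP)// -(meanZ CP)//; apply: (mean_le CP) => // b.
  rewrite sumrB sumr_const card_ord -mulr_natl big_split/= -!mulr_sumr.
  have := sum_Z_remove FF0 FFsym FFdiag FFbound (tnth x) (signsP b).
  have := sum_W_remove FF0 FFsym FFdiag FFbound (tnth x) (signsP b).
  rewrite -/(Zb b x) -/(Wb b x).
  have := mulr_ge0 l0 (Z0 b x).
  move=> + /(ler_wpM2l t0) + /(ler_wpM2l l0).
  rewrite !mulrDr -/(\sum_i Zr b i x) -/(\sum_i Wr b i x) /Zr /Wr; lra.
- by apply: addr_ge0; apply: mulr_ge0; rewrite ?sqr_ge0//; apply: mulr_ge0.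
Qed.

Let GE : tuple_mean nu G = joint_mean Zb. Proof. by []. Qed.
Let KE : tuple_mean nu K = joint_mean Wb. Proof. by []. Qed.

Let joint_le (g h : {ffun 'I_n -> bool} -> n.-tuple S -> R) :
  (forall b, ok (g b)) -> (forall b, ok (h b)) ->
  (forall b x, g b x <= h b x) -> joint_mean g <= joint_mean h.
Proof.
move=> okg okh gh; apply: (mean_le EP); [exact: cube_ok..|] => x.
exact: (mean_le CP).
Qed.

(** The sign bound doubles the exponent, so the sample bound is applied at [(2 l, 2 t)] and doubles
    it again. *)
Lemma joint_mgf l t : 0 <= l -> 0 <= t ->
  64 * (l ^+ 2 + t ^+ 2 * c ^+ 2) <= t -> 2 * (2 * l * c + 3 * t * c ^+ 2) <= 24^-1 ->
  joint_mean (fun b x => expR (l * Zb b x + t * Wb b x)) <=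
  expR (4 * (l * joint_mean Zb + t * joint_mean Wb)).
Proof.
move=> l0 t0 lt J24.
apply: (@le_trans _ _ (tuple_mean nu (fun x => expR (2 * l * G x + 2 * t * K x)))).
  apply: (mean_le EP).
  - apply: cube_ok => b; apply: (fc_expR okP).
    exact: (fcD okP (fcZ okP l (okZ b)) (fcZ okP t (okW b))).
  - apply: (fc_expR okP); exact: (fcD okP (fcZ okP _ okG) (fcZ okP _ okK)).
  move=> x; apply: le_trans (rademacher_mgf x l0 t0 lt) _.
  by rewrite mulrDr !mulrA.
have := @sample_mgf (2 * l) (2 * t); rewrite !mulr_ge0// => /(_ isT isT).
move=> H; apply: le_trans (H _) _; first lra.
by rewrite ler_expR -GE -KE; lra.
Qed.

Let ok_lin a d f g : ok f -> ok g -> ok (fun x => a * f x + d * g x).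
Proof. by move=> okf okg; exact: (fcD okP (fcZ okP a okf) (fcZ okP d okg)). Qed.

Let joint_lin (a d : R) (g h : {ffun 'I_n -> bool} -> n.-tuple S -> R) :
  (forall b, ok (g b)) -> (forall b, ok (h b)) ->
  joint_mean (fun b x => a * g b x + d * h b x) = a * joint_mean g + d * joint_mean h.
Proof.
move=> okg okh; rewrite /joint_mean -!(meanZ EP); [|exact: cube_ok..].
rewrite -(meanD EP); [|by apply: (fcZ okP); exact: cube_ok..].
by congr tuple_mean; apply/funext => x; rewrite (meanD CP)// !(meanZ CP).
Qed.

Let expR_ge_sqr (u : R) : 0 <= u -> u ^+ 2 <= 4 * expR u.
Proof.
move=> u0; have -> : expR u = expR (u / 2) ^+ 2.
  by rewrite expr2 -expRD; congr expR; lra.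
by have := expR_ge1Dx (u / 2); nra.
Qed.

(** A reverse Hoelder argument. When the mean [w] of [W] exceeds [c^2], exponential moments at scale
    [1 / w] give [E W^2 <= C w^2]. Then large values of [U] cannot carry most of the mean of
    [W = U^2], and truncating at a level [k] of order [sqrt w] bounds [w] by a multiple of
    [k E U]. *)
Lemma joint_W_le : 0 < c ->
  joint_mean Wb <= 64 * 144 ^+ 2 * (joint_mean Ub ^+ 2 + c ^+ 2).
Proof.
move=> c0; set w := joint_mean Wb; set u := joint_mean Ub.
have c2 : 0 < c ^+ 2 by rewrite exprn_gt0.
have [C [CE C1]] : exists C : R, C = 8 * 144 ^+ 2 /\ 1 <= C.
  by eexists; split; first reflexivity; lra.
have -> : 64 * 144 ^+ 2 = 8 * C by rewrite CE; ring.
have [wc|cw] := leP w (c ^+ 2).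
  by have := sqr_ge0 u; nra.
have w0 : 0 < w by exact: lt_trans cw.
(* 144 is 6 times 24: with [l = 0], the second condition of [joint_mgf] reads [6 t c^2 <= 1/24]. *)
pose t := (144 * w)^-1.
have t0 : 0 < t by rewrite invr_gt0 mulr_gt0.
have tw : t * w = 144^-1 by rewrite /t; field; rewrite gt_eqF.
have tc : t * c ^+ 2 <= 144^-1 by rewrite -tw ler_pM2l// ltW.
have H : joint_mean (fun b x => expR (t * Wb b x)) <= 2.
  have := @joint_mgf 0 t (lexx _) (ltW t0).
  rewrite expr0n/= add0r mulr0 mul0r add0r mul0r add0r.
  under [X in joint_mean X]eq_fun do under eq_fun do rewrite mul0r add0r.
  move=> H; apply: le_trans (H _ _) _.
  - by have -> : 64 * (t ^+ 2 * c ^+ 2) = (64 * (t * c ^+ 2)) * t; [ring|rewrite ger_pMl//; lra].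
  - lra.
  rewrite -/w tw; set v := 4 / 144.
  have := expR_ge1Dx (- v); rewrite expRN => K1.
  have e0 := expR_gt0 v.
  have : (1 - v) * expR v <= 1 by rewrite -ler_pdivlMr// div1r.
  rewrite /v in e0 *; lra.
have okW2 b : ok (fun x => Wb b x ^+ 2).
  by under eq_fun do rewrite expr2; apply: (fcM okP); exact: okW.
have okeW b : ok (fun x => expR (t * Wb b x)) by apply: fc_exp_scale => //; exact: okP.
pose w2 := joint_mean (fun b x => Wb b x ^+ 2).
have W2 : w2 <= C * w ^+ 2.
  have : t ^+ 2 * w2 + 0 * w2 <= 4 * 2 + 0 * w2.
    rewrite -joint_lin//.
    apply: (@le_trans _ _ (4 * joint_mean (fun b x => expR (t * Wb b x)) + 0 * w2)).
      rewrite -joint_lin//; apply: joint_le => [b|b|b x].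
      - exact: ok_lin.
      - exact: ok_lin.
      rewrite lerD2r -exprMn; apply: expR_ge_sqr.
      by rewrite mulr_ge0// ltW.
    by rewrite lerD2r ler_pM2l.
  rewrite mul0r !addr0 => H2.
  have t2 : 0 < t ^+ 2 by rewrite exprn_gt0.
  rewrite -(ler_pM2l t2); apply: (le_trans H2).
  have -> : t ^+ 2 * (C * w ^+ 2) = C * (t * w) ^+ 2 by ring.
  by rewrite tw CE le_eqVlt; apply/orP; left; apply/eqP; field.
(* With [k^2 = 2 C w], the bound [W^2 / k^2] used beyond the level [U = k] has mean at most
   [w / 2]. *)
pose k := Num.sqrt (2 * C * w).
have k2 : k ^+ 2 = 2 * C * w by rewrite sqr_sqrtr// !mulr_ge0 ?(ltW w0)//; lra.
have k0 : 0 < k by rewrite sqrtr_gt0 !mulr_gt0//; lra.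
have H1 : w <= k * u + (k ^+ 2)^-1 * w2.
  rewrite -joint_lin//; apply: joint_le => // [b|b x].
    exact: ok_lin.
  rewrite /Wb /sup_W -/(Ub b x).
  have U0 : 0 <= Ub b x by exact: (sup_Ueps_ge0 FF0 FFsym FFdiag FFbound _ (signsP b)).
  have k20 : 0 < k ^+ 2 by rewrite exprn_gt0.
  have [Uk|kU] := leP (Ub b x) k.
    apply: (@le_trans _ _ (k * Ub b x)); first by rewrite expr2 ler_wpM2r.
    by rewrite lerDl mulr_ge0 ?sqr_ge0// invr_ge0 ltW.
  apply: (@le_trans _ _ ((k ^+ 2)^-1 * (Ub b x ^+ 2) ^+ 2)); last first.
    by rewrite lerDr mulr_ge0// ltW.
  rewrite mulrC ler_pdivlMr// expr2 ler_wpM2l ?sqr_ge0//.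
  by rewrite -expr2 lerXn2r ?nnegrE// ltW.
have H3 : (k ^+ 2)^-1 * w2 <= w / 2.
  rewrite mulrC ler_pdivrMr ?exprn_gt0// k2.
  by have -> : w / 2 * (2 * C * w) = C * w ^+ 2 by field.
have u0 : 0 <= u.
  have : 0 * u + 0 * u <= 1 * u + 0 * u.
    rewrite -!joint_lin//; apply: joint_le => [b|b|b x].
    - exact: ok_lin.
    - exact: ok_lin.
    rewrite !mul0r mul1r addr0 addr0.
    exact: (sup_Ueps_ge0 FF0 FFsym FFdiag FFbound _ (signsP b)).
  lra.
have H4 : w <= 2 * (k * u) by lra.
have H5 : w ^+ 2 <= (8 * C * u ^+ 2) * w.
  have -> : 8 * C * u ^+ 2 * w = (2 * (k * u)) ^+ 2.
    by rewrite !exprMn k2; ring.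
  by rewrite lerXn2r ?nnegrE ?(ltW w0)// (le_trans (ltW w0)).
have H6 : w <= 8 * C * u ^+ 2 by rewrite expr2 ler_pM2r in H5.
have := mulr_ge0 (_ : 0 <= 8 * C) (ltW c2); nra.
Qed.

Lemma chaos_mgf l : 0 <= l -> 0 < c -> l * c <= 256^-1 ->
  joint_mean (fun b x => expR (l * Zb b x)) <=
  expR (4 * l * joint_mean Zb +
    512 * (64 * 144 ^+ 2) * l ^+ 2 * (joint_mean Ub ^+ 2 + c ^+ 2)).
Proof.
(* Half of [t = 128 l^2] covers the [64 l^2] demanded by [joint_mgf]; the other half absorbs
   [64 t^2 c^2] because [l c <= 1/256]. *)
move=> l0 c0 lc; pose t := 128 * l ^+ 2.
have t0 : 0 <= t by rewrite mulr_ge0// sqr_ge0.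
have lc2 : (l * c) ^+ 2 <= 256^-1 * 256^-1.
  by rewrite expr2; apply: ler_pM => //; rewrite mulr_ge0// ltW.
apply: (@le_trans _ _ (joint_mean (fun b x => expR (l * Zb b x + t * Wb b x)))).
  apply: joint_le => [b|b|b x].
  - by apply: fc_exp_scale => //; exact: okP.
  - apply: (fc_expR okP).
    exact: (fcD okP (fcZ okP l (okZ b)) (fcZ okP t (okW b))).
  by rewrite ler_expR lerDl mulr_ge0.
have tc : t * c ^+ 2 = 128 * (l * c) ^+ 2 by rewrite /t; ring.
apply: le_trans (joint_mgf l0 t0 _ _) _.
- have -> : t ^+ 2 * c ^+ 2 = l ^+ 2 * (128 * (t * c ^+ 2)) by rewrite /t; ring.
  by rewrite tc /t; have := sqr_ge0 l; nra.
- have -> : 2 * (2 * l * c + 3 * t * c ^+ 2) = 4 * (l * c) + 6 * (t * c ^+ 2) by ring.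
  by rewrite tc; lra.
rewrite ler_expR.
have := ler_wpM2l (_ : 0 <= 4 * t) (joint_W_le c0); rewrite mulr_ge0// => /(_ isT).
rewrite /t; lra.
Qed.

End chaos_mgf.

(** * Symmetrization of degenerate U-processes *)

Section symmetrization.
Context {R : realType} {dS : measure_display} {S : measurableType dS} {n : nat}.
Variables (mu : probability S R) (nu : probability (n.-tuple S) R).
Hypothesis nuE : forall A : 'I_n -> set S, (forall i, measurable (A i)) ->
  nu [set x | forall i, A i (tnth x i)] = (\prod_i mu (A i))%E.
Variables (FF : set (S -> S -> R)) (F : R).
Hypothesis FF0 : FF !=set0.
Hypothesis FFsym : forall f, FF f -> forall x y, f x y = f y x.
Hypothesis FFdiag : forall f, FF f -> forall x, f x x = 0.
Hypothesis FFbound : forall f, FF f -> forall x y, `|f x y| <= F.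
Hypothesis FFmeas : forall f, FF f ->
  measurable_fun [set: S * S] (fun xy : S * S => f xy.1 xy.2).
Hypothesis FFdeg : forall f, FF f -> forall y, \int[mu]_s f s y = 0.

Let Zb (b : {ffun 'I_n -> bool}) (x : n.-tuple S) : R :=
  sup_Zeps FF (signs b) (tnth x).
Let Zs (x : n.-tuple S) : R := sup_Z FF (tnth x).

Hypothesis mZ : forall b, measurable_fun [set: n.-tuple S] (Zb b).
Hypothesis mZs : measurable_fun [set: n.-tuple S] Zs.

Local Notation c := (F * n%:R).
Let ok := @bounded_measurable R _ (n.-tuple S).
Let okP := @bounded_measurable_class R _ (n.-tuple S).
Let EP := Rintegral_mean nu : mean ok (tuple_mean nu).
Let MP := Rintegral_mean mu.
Let CP := @cube_meanP R 'I_n.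
Let CC := @cube_function_class R 'I_n.
Let PM := tuple_product_mean nuE.
Let integrate : (n.-tuple S -> R) -> seq 'I_n -> n.-tuple S -> R :=
  foldr (coord_mean mu).

Let okZ b : ok (Zb b).
Proof. exact: (bounded_measurable_sup_Zeps FF0 FFsym FFdiag FFbound (mZ b)). Qed.

Let ok_integrate g s : ok g -> ok (integrate g s).
Proof. by move=> okg; elim: s => //= k s; exact: (pm_ok PM). Qed.

Let integrate_le f g s x : ok f -> ok g -> (forall x, f x <= g x) ->
  integrate f s x <= integrate g s x.
Proof.
move=> okf okg fg; elim: s x => //= k s IH x.
by apply: (mean_le (pm_mean PM k x)) => //; exact: ok_integrate.
Qed.

Let integrate_expR (h : n.-tuple S -> R) s x : ok h ->
  expR (integrate h s x) <= integrate (fun x => expR (h x)) s x.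
Proof.
move=> okh; elim: s x => //= k s IH x.
apply: (le_trans (expR_mean_le okP (pm_mean PM k x) (ok_integrate s okh))).
apply: (mean_le (pm_mean PM k x)) => //.
  by apply: (fc_expR okP); exact: ok_integrate.
by apply: ok_integrate; exact: (fc_expR okP).
Qed.

Let integrateZ a g s x : ok g -> integrate (fun x => a * g x) s x = a * integrate g s x.
Proof.
move=> okg; elim: s x => //= k s IH x.
rewrite -(meanZ (pm_mean PM k x)); last exact: ok_integrate.
by congr coord_mean; apply/funext.
Qed.

Let mean_integrate g s : ok g -> tuple_mean nu (integrate g s) = tuple_mean nu g.
Proof.
by move=> okg; elim: s => //= k s <-; exact: (pm_E PM k (ok_integrate s okg)).
Qed.

Section one_kernel.
Variable f : S -> S -> R.
Hypothesis Ff : FF f.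

Let quad (a : 'I_n -> 'I_n -> R) (x : n.-tuple S) : R :=
  \sum_i \sum_j a i j * f (tnth x i) (tnth x j).

Let ok_entry i j : ok (fun x => f (tnth x i) (tnth x j)).
Proof.
split; last by exists F => x; exact: FFbound.
have mp : measurable_fun [set: n.-tuple S] (fun x : n.-tuple S => (tnth x i, tnth x j)).
  by apply: measurable_fun_pair; exact: measurable_tnth.
exact: (measurableT_comp (FFmeas Ff) mp).
Qed.

Let ok_quad a : ok (quad a).
Proof.
apply: (fc_sum okP) => i; apply: (fc_sum okP) => j.
by apply: (fcZ okP); exact: ok_entry.
Qed.

(** Degeneracy, used in either argument through symmetry, kills every term with exactly one index
    [k], and the zero diagonal kills the term [(k, k)]. *)
Let coord_mean_quad k a x :
  coord_mean mu k (quad a) x =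
  quad (fun i j => a i j * ((i != k)%:R * (j != k)%:R)) x.
Proof.
have Mk := pm_mean PM k x.
rewrite (mean_sum okP Mk); last first.
  by move=> i; apply: (fc_sum okP) => j; apply: (fcZ okP); exact: ok_entry.
apply: eq_bigr => i _; rewrite (mean_sum okP Mk); last first.
  by move=> j; apply: (fcZ okP); exact: ok_entry.
apply: eq_bigr => j _; rewrite (meanZ Mk) -?mulrA; last exact: ok_entry.
congr (_ * _); rewrite /coord_mean.
under eq_Rintegral => s _ do rewrite !tnth_upd.
have [_|ik] := eqVneq i k; have [_|jk] := eqVneq j k; rewrite ?mul0r ?mulr0 ?mul0r ?mul1r.
- by apply: (mean_cst_fun MP) => s; exact: FFdiag.
- exact: FFdeg.
- rewrite -(FFdeg Ff (tnth x i)); apply: eq_Rintegral => s _; exact: FFsym.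
- exact: (mean_cst_fun MP).
Qed.

Let integrate_quad s a x :
  integrate (quad a) s x =
  quad (fun i j => a i j * ((i \notin s)%:R * (j \notin s)%:R)) x.
Proof.
elim: s x => [|k s IH] x /=.
  by apply: eq_bigr => i _; apply: eq_bigr => j _; rewrite !mulr1.
rewrite (_ : integrate (quad a) s =
   quad (fun i j => a i j * ((i \notin s)%:R * (j \notin s)%:R))); last exact/funext.
rewrite coord_mean_quad; apply: eq_bigr => i _; apply: eq_bigr => j _.
congr (_ * _); rewrite !inE !negb_or.
by case: (i == k) (j == k) (i \in s) (j \in s) => [] [] [] [] /=; ring.
Qed.

Let drawn (b : {ffun 'I_n -> bool}) : seq 'I_n :=
  [seq i <- index_enum _ | b i].

Let cube_mean_quarter (i j : 'I_n) : i != j ->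
  cube_mean (fun b : {ffun 'I_n -> bool} => (~~ b i)%:R * (~~ b j)%:R) = 4^-1 :> R.
Proof.
move=> ij; rewrite -(pm_E cube_product_mean i)// -(pm_E cube_product_mean j)//.
apply: (mean_cst_fun CP) => b; rewrite /flip_mean !ffunE !eqxx.
rewrite (negbTE ij) eq_sym (negbTE ij) /=.
by case: (b i) (b j) => [] [] /=; field.
Qed.

(** [b] plays two roles: it is the sign pattern and the set of points integrated out. The kept
    points have sign +1, and degeneracy leaves their unsigned sum; a pair of distinct points is kept
    for a quarter of all [b], whence the factor 4. As [b] runs over the cube its signs are uniform,
    so averaging over [b] restores Rademacher signs. *)
Lemma symmetrization_kernel (x : n.-tuple S) :
  `|\sum_i \sum_j f (tnth x i) (tnth x j)| <=
  4 * cube_mean (fun b => integrate (Zb b) (drawn b) x).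
Proof.
(* The factor [t], equal to 1 or -1, yields the two halves of the absolute value. *)
pose a (t : R) (b : {ffun 'I_n -> bool}) i j : R := t * (signs b i * signs b j).
have aZ t b y : `|t| = 1 -> quad (a t b) y <= Zb b y.
  move=> t1; apply: le_trans (ler_norm _) _.
  have -> : quad (a t b) y = t * chaos (kernel_at (tnth y) f) (signs b).
    rewrite /quad /chaos mulr_sumr; apply: eq_bigr => i _; rewrite mulr_sumr.
    by apply: eq_bigr => j _; rewrite /a /kernel_at -!mulrA.
  by rewrite normrM t1 mul1r; exact: (chaos_le_sup FFsym FFdiag FFbound _ (signsP b)).
have key t : `|t| = 1 -> t * \sum_i \sum_j f (tnth x i) (tnth x j) <=
    4 * cube_mean (fun b => integrate (Zb b) (drawn b) x).
  move=> t1.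
  have -> : t * \sum_i \sum_j f (tnth x i) (tnth x j) =
      4 * cube_mean (fun b => integrate (quad (a t b)) (drawn b) x).
    under [in RHS]eq_fun do rewrite integrate_quad.
    rewrite (mean_sum CC CP)// !mulr_sumr; apply: eq_bigr => i _.
    rewrite (mean_sum CC CP)// !mulr_sumr; apply: eq_bigr => j _.
    have [->|ij] := eqVneq i j.
      rewrite FFdiag// mulr0 (mean_cst_fun CP (c := 0)) ?mulr0// => b.
      by rewrite mulr0.
    under eq_fun do rewrite mulrC.
    rewrite (_ : (fun b => _) = fun b : {ffun 'I_n -> bool} =>
       (f (tnth x i) (tnth x j) * t) * ((~~ b i)%:R * (~~ b j)%:R)); last first.
      apply/funext => b; rewrite /a /signs !mem_filter !mem_index_enum !andbT.
      by case: (b i) (b j) => [] [] /=; rewrite ?expr0; ring.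
    by rewrite (meanZ CP)// cube_mean_quarter//; field.
  rewrite ler_pM2l//; apply: (mean_le CP) => // b.
  by apply: integrate_le => // y; exact: aZ.
rewrite ler_norml; apply/andP; split.
  by have := key (-1); rewrite normrN1 => /(_ erefl); lra.
by have := key 1; rewrite normr1 => /(_ erefl); lra.
Qed.

End one_kernel.

Let Q (b : {ffun 'I_n -> bool}) (x : n.-tuple S) : R :=
  integrate (Zb b) [seq i <- index_enum _ | b i] x.

Let okQ b : ok (Q b). Proof. exact: ok_integrate. Qed.

Lemma symmetrization_pointwise x : Zs x <= 4 * cube_mean (Q ^~ x).
Proof. by apply: image_sup_le => // f Ff; exact: symmetrization_kernel. Qed.

Lemma sup_Z_ge0 x : 0 <= Zs x.
Proof.
have [f Ff] := FF0.
apply: le_trans (image_sup_ub (phi := fun f => `|\sum_i \sum_j f (tnth x i) (tnth x j)|)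
  (B := 4 * cube_mean (Q ^~ x)) _ Ff) => // g Fg.
exact: symmetrization_kernel.
Qed.

Lemma ok_sup_Z : ok Zs.
Proof.
split=> //; have : ok (fun x => 4 * cube_mean (Q ^~ x)).
  by apply: (fcZ okP); exact: cube_ok.
move=> [_ [M QM]]; exists M => x; rewrite ger0_norm ?sup_Z_ge0//.
apply: (le_trans (symmetrization_pointwise x)); apply: le_trans (QM x).
exact: ler_norm.
Qed.

Let cube_mean_tuple_mean (g : {ffun 'I_n -> bool} -> n.-tuple S -> R) :
  (forall b, ok (g b)) ->
  tuple_mean nu (fun x => cube_mean (g ^~ x)) = cube_mean (fun b => tuple_mean nu (g b)).
Proof.
move=> okg; rewrite /cube_mean (meanZ EP); last exact: (fc_sum okP).
by rewrite (mean_sum okP EP).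
Qed.

Lemma symmetrization_mean : tuple_mean nu Zs <= 4 * joint_mean nu Zb.
Proof.
apply: (@le_trans _ _ (tuple_mean nu (fun x => 4 * cube_mean (Q ^~ x)))).
  apply: (mean_le EP); [exact: ok_sup_Z| |exact: symmetrization_pointwise].
  by apply: (fcZ okP); exact: cube_ok.
rewrite (meanZ EP); last exact: cube_ok.
rewrite /joint_mean !cube_mean_tuple_mean// ler_pM2l//.
by apply: (mean_le CP) => // b; rewrite mean_integrate.
Qed.

(** Jensen's inequality twice, for the average over [b] and for the points integrated out; that
    integration then disappears under [tuple_mean]. *)
Lemma symmetrization_mgf l : 0 <= l ->
  tuple_mean nu (fun x => expR (l * Zs x)) <=
  joint_mean nu (fun b x => expR (4 * l * Zb b x)).
Proof.
move=> l0.
have okeQ b : ok (fun x => expR (4 * l * Q b x)).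
  by apply: fc_exp_scale => //; exact: okP.
have okeZ b : ok (fun x => expR (4 * l * Zb b x)).
  by apply: fc_exp_scale => //; exact: okP.
apply: (@le_trans _ _ (tuple_mean nu (fun x => cube_mean (fun b => expR (4 * l * Q b x))))).
  apply: (mean_le EP).
  - by apply: fc_exp_scale; [exact: okP|exact: ok_sup_Z].
  - exact: cube_ok.
  move=> x; apply: le_trans (expR_mean_le CC CP _) => //.
  rewrite ler_expR (meanZ CP)//.
  by have := ler_wpM2l l0 (symmetrization_pointwise x); lra.
rewrite /joint_mean !cube_mean_tuple_mean//.
apply: (mean_le CP) => // b.
rewrite -(mean_integrate [seq i <- index_enum _ | b i] (okeZ b)).
apply: (mean_le EP) => //; first exact: ok_integrate.
move=> x; rewrite -integrateZ//; apply: integrate_expR; exact: (fcZ okP _ (okZ b)).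
Qed.

End symmetrization.

(** * Moments and tails on the product space *)

(* The variance proxy in [chaos_mgf], and the value of l c for which it can be
   absorbed in [sup_Z_tail]. *)
Definition mgf_cst (R : realType) : R := 512 * (64 * 144 ^+ 2).
Definition mgf_range (R : realType) : R := (64 * mgf_cst R)^-1.
Definition moment_cst (R : realType) : R := 16 / 1024 + 32 * mgf_cst R / 1024 ^+ 2.

Lemma mgf_cst_ge (R : realType) : 1024 <= mgf_cst R.
Proof. by rewrite /mgf_cst; lra. Qed.

Lemma bounded_measurable_powR {R : realType} {d : measure_display}
    {T : measurableType d} (g : T -> R) q :
  bounded_measurable g -> (forall x, 0 <= g x) -> 0 <= q ->
  bounded_measurable (fun x => g x `^ q).
Proof.
move=> [mg [M gM]] g0 q0.
split; first exact: (measurableT_comp (measurable_powR q) mg).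
exists (M `^ q) => x; rewrite ger0_norm ?powR_ge0//.
apply: ge0_ler_powR; rewrite ?nnegrE//; first exact: le_trans (gM x).
exact: le_trans (ler_norm _) (gM x).
Qed.

Section concentration.
Context {R : realType} {dS : measure_display} {S : measurableType dS} {n : nat}.
Variables (mu : probability S R) (nu : probability (n.-tuple S) R).
Hypothesis nuE : forall A : 'I_n -> set S, (forall i, measurable (A i)) ->
  nu [set x | forall i, A i (tnth x i)] = (\prod_i mu (A i))%E.
Variables (FF : set (S -> S -> R)) (F : R).
Hypothesis FF0 : FF !=set0.
Hypothesis FFsym : forall f, FF f -> forall x y, f x y = f y x.
Hypothesis FFdiag : forall f, FF f -> forall x, f x x = 0.
Hypothesis FFbound : forall f, FF f -> forall x y, `|f x y| <= F.
Hypothesis FFmeas : forall f, FF f ->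
  measurable_fun [set: S * S] (fun xy : S * S => f xy.1 xy.2).
Hypothesis FFdeg : forall f, FF f -> forall y, \int[mu]_s f s y = 0.

Let Zb (b : {ffun 'I_n -> bool}) (x : n.-tuple S) : R :=
  sup_Zeps FF (signs b) (tnth x).
Let Ub (b : {ffun 'I_n -> bool}) (x : n.-tuple S) : R :=
  sup_Ueps FF (signs b) (tnth x).
Let Zs (x : n.-tuple S) : R := sup_Z FF (tnth x).

Hypothesis mZ : forall b, measurable_fun [set: n.-tuple S] (Zb b).
Hypothesis mU : forall b, measurable_fun [set: n.-tuple S] (Ub b).
Hypothesis mZs : measurable_fun [set: n.-tuple S] Zs.

Let z := joint_mean nu Zb.
Let u := joint_mean nu Ub.
Local Notation c := (F * n%:R).
Let ok := @bounded_measurable R _ (n.-tuple S).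
Let okP := @bounded_measurable_class R _ (n.-tuple S).
Let EP := Rintegral_mean nu : mean ok (tuple_mean nu).
Let B := mgf_cst R.

Let okZs : ok Zs.
Proof. exact: (ok_sup_Z nuE FF0 FFsym FFdiag FFbound FFmeas FFdeg mZ mZs). Qed.

Let Zs0 x : 0 <= Zs x.
Proof. exact: (sup_Z_ge0 nuE FF0 FFsym FFdiag FFbound FFmeas FFdeg mZ). Qed.

(** [chaos_mgf] at [4 l], whence 1024 as 4 times 256 and both factors 16. *)
Lemma sup_Z_mgf l : 0 < c -> 0 <= l -> l * c <= 1024^-1 ->
  tuple_mean nu (fun x => expR (l * Zs x)) <=
  expR (16 * l * z + 16 * B * l ^+ 2 * (u ^+ 2 + c ^+ 2)).
Proof.
move=> c0 l0 lc.
apply: (le_trans (symmetrization_mgf nuE FF0 FFsym FFdiag FFbound FFmeas FFdeg mZ mZs l0)).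
apply: (le_trans (chaos_mgf nuE FF0 FFsym FFdiag FFbound mZ mU _ c0 _)).
- by rewrite mulr_ge0.
- by rewrite -mulrA; lra.
by rewrite ler_expR /B /mgf_cst -/z -/u le_eqVlt; apply/orP; left; apply/eqP; ring.
Qed.

Lemma sup_Zeps_mean_ge0 : 0 <= z.
Proof.
apply: (mean_ge0 okP EP); last first.
  move=> x; apply: (mean_ge0 (@cube_function_class R 'I_n) (@cube_meanP R 'I_n)) => // b.
  exact: (sup_Zeps_ge0 FF0 FFsym FFdiag FFbound _ (signsP b)).
apply: cube_ok => b.
exact: (bounded_measurable_sup_Zeps FF0 FFsym FFdiag FFbound (mZ b)).
Qed.

Lemma sup_Ueps_mean_ge0 : 0 <= u.
Proof.
apply: (mean_ge0 okP EP); last first.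
  move=> x; apply: (mean_ge0 (@cube_function_class R 'I_n) (@cube_meanP R 'I_n)) => // b.
  exact: (sup_Ueps_ge0 FF0 FFsym FFdiag FFbound _ (signsP b)).
apply: cube_ok => b.
exact: (bounded_measurable_sup_Ueps FF0 FFsym FFdiag FFbound (mU b)).
Qed.

Let zge0 := sup_Zeps_mean_ge0.
Let uge0 := sup_Ueps_mean_ge0.

(** From [y <= exp y] at [y = l x / q]. *)
Lemma sup_Z_powR_le (l q x : R) : 0 < l -> 0 < q -> 0 <= x ->
  x `^ q <= (q / l) `^ q * expR (l * x).
Proof.
move=> l0 q0 x0.
have ql : 0 <= q / l by rewrite divr_ge0 ?ltW.
have -> : l * x = l * x / q * q by field; rewrite gt_eqF.
rewrite expRM -powRM ?expR_ge0//; apply: ge0_ler_powR; rewrite ?nnegrE ?(ltW q0)//.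
  by rewrite mulr_ge0 ?expR_ge0.
have H : l * x / q <= expR (l * x / q) by have := expR_ge1Dx (l * x / q); lra.
have := ler_wpM2l ql H.
by have -> : q / l * (l * x / q) = x by field; rewrite !gt_eqF.
Qed.

Lemma sup_Z_moment q : 0 < c -> 1 <= q ->
  tuple_mean nu (fun x => Zs x `^ q) <=
  (1024 * expR (moment_cst R) * (z + Num.sqrt q * u + q * c)) `^ q.
Proof.
have [N NE] : exists N : R, N = 1024 by exists 1024.
have N0 : 0 < N by rewrite NE ltr0n.
have := sup_Z_mgf; rewrite /moment_cst -NE => mgf.
move=> c0 q1; have q0 : 0 < q by exact: lt_le_trans q1.
set A := 16 / N + _; set s := Num.sqrt q; set D := z + _ + _.
have z0 : 0 <= z by exact: zge0.
have s2 : s ^+ 2 = q by rewrite sqr_sqrtr// ltW.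
have s0 : 0 <= s by exact: sqrtr_ge0.
have su0 : 0 <= s * u by rewrite mulr_ge0.
have qc0 : 0 < q * c by rewrite mulr_gt0.
have DE : D = z + s * u + q * c by [].
clearbody D; clearbody s.
have D0 : 0 < D by rewrite DE ltr_wpDl// addr_ge0.
(* This [l] bounds [l c] and [l z / q] by [1 / N], and [l^2 u^2 / q] and [l^2 c^2 / q] by [1 / N^2],
   the last through [q >= 1]. The exponent is then at most [q A], while [q / l = N D]. *)
pose l := q / (N * D).
have l0 : 0 < l by apply: divr_gt0 => //; apply: mulr_gt0.
have lD : l * D = q / N by rewrite /l; field; rewrite !gt_eqF.
have lc : l * c <= N^-1.
  rewrite -(ler_pM2l q0); apply: (@le_trans _ _ (l * D)).
    by rewrite mulrCA ler_pM2l//; lra.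
  by rewrite lD.
have lz : l * z <= q / N by rewrite -lD ler_pM2l//; lra.
have lu : l ^+ 2 * u ^+ 2 <= q / N ^+ 2.
  rewrite -(ler_pM2l q0).
  have -> : q * (l ^+ 2 * u ^+ 2) = (l * (s * u)) ^+ 2 by rewrite !exprMn s2; ring.
  have -> : q * (q / N ^+ 2) = (l * D) ^+ 2 by rewrite lD; field; rewrite gt_eqF.
  have suD : l * (s * u) <= l * D by rewrite ler_pM2l//; lra.
  by apply: lerXn2r => //; rewrite nnegrE; apply: mulr_ge0 => //; exact: ltW.
have lc2 : l ^+ 2 * c ^+ 2 <= q / N ^+ 2.
  rewrite -exprMn; apply: (@le_trans _ _ (N^-1 ^+ 2)).
    apply: lerXn2r => //; rewrite nnegrE; last by rewrite invr_ge0 ltW.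
    by apply: mulr_ge0; exact: ltW.
  by rewrite exprVn -[leLHS]mul1r ler_pM2r ?invr_gt0 ?exprn_gt0.
have okpow := bounded_measurable_powR okZs Zs0 (ltW q0).
apply: (@le_trans _ _ (tuple_mean nu (fun x => (q / l) `^ q * expR (l * Zs x)))).
  apply: (mean_le EP) => // [|x]; last exact: sup_Z_powR_le.
  by apply: (fcZ okP); apply: fc_exp_scale => //; exact: okP.
rewrite (meanZ EP); last by apply: fc_exp_scale => //; exact: okP.
have -> : N * expR A * D = q / l * expR A.
  by rewrite /l; field; rewrite !gt_eqF.
have ql0 : 0 <= q / l by apply: divr_ge0; exact: ltW.
rewrite (powRM _ ql0 (expR_ge0 A)) -expRM.
rewrite ler_wpM2l ?powR_ge0//.
apply: (le_trans (mgf _ c0 (ltW l0) lc)); rewrite ler_expR.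
have B0 : 0 <= B by apply: le_trans (mgf_cst_ge R); rewrite -NE ltW.
have := ler_wpM2l B0 lu; have := ler_wpM2l B0 lc2; rewrite /A -/B; lra.
Qed.

Let indic_mean (A : set (n.-tuple S)) : measurable A ->
  ok (\1_A : _ -> R) /\ tuple_mean nu (\1_A) = fine (nu A).
Proof.
move=> mA; split.
  split; first exact: measurable_indic.
  by exists 1 => x; rewrite indicE; case: (_ \in _); rewrite ?normr1 ?normr0.
by rewrite /tuple_mean /Rintegral integral_indic// setIT.
Qed.

Let measurable_exceed a : measurable [set x | a < Zs x].
Proof.
rewrite -[X in measurable X]setTI.
have -> : [set x | a < Zs x] = Zs @^-1` `]a, +oo[%classic.
  by apply/seteqP; split=> x /=; rewrite in_itv/= andbT.
exact: mZs.
Qed.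

(** Chernoff's bound: [a >= 16] absorbs [16 l z], and [u^2] and [c^2] contribute at most [16 / 64]
    of [l t] each, which leaves [l t / 2]. *)
Lemma sup_Z_tail a t l : 16 <= a -> 0 < c -> c <= t -> 0 <= l ->
  l * c <= mgf_range R -> l * u ^+ 2 <= mgf_range R * t ->
  fine (nu [set x | a * z + t < Zs x]) <= expR (- (l * t / 2)).
Proof.
move=> a16 c0 ct l0 lc lu.
have [okA <-] := indic_mean (measurable_exceed (a * z + t)).
have t0 : 0 < t by exact: lt_le_trans ct.
have B1 := mgf_cst_ge R; have B0 : 0 < mgf_cst R by lra.
have rB : mgf_range R * mgf_cst R = 64^-1.
  by rewrite /mgf_range; field; rewrite gt_eqF.
have r1024 : mgf_range R <= 1024^-1.
  rewrite -(ler_pM2r B0) rB; lra.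
apply: (@le_trans _ _ (expR (- (l * (a * z + t))) *
    tuple_mean nu (fun x => expR (l * Zs x)))).
  rewrite -(meanZ EP); last by apply: fc_exp_scale => //; exact: okP.
  apply: (mean_le EP) => // [|x].
    by apply: (fcZ okP); apply: fc_exp_scale => //; exact: okP.
  rewrite -expRD indicE; case: (boolP (x \in _)); last by rewrite expR_ge0.
  rewrite inE/= => xA; rewrite -expR0 ler_expR.
  have := ler_wpM2l l0 (ltW xA); lra.
apply: (le_trans (ler_wpM2l (expR_ge0 _) (sup_Z_mgf c0 l0 (le_trans lc r1024)))).
rewrite -expRD ler_expR.
have lz : 16 * (l * z) <= a * (l * z) by rewrite ler_wpM2r// mulr_ge0.
have Bl0 : 0 <= B * l := mulr_ge0 (ltW B0) l0.
have H1 : B * l ^+ 2 * u ^+ 2 <= 64^-1 * (l * t).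
  have -> : B * l ^+ 2 * u ^+ 2 = (B * l) * (l * u ^+ 2) by ring.
  have -> : 64^-1 * (l * t) = (B * l) * (mgf_range R * t) by rewrite -rB /B; ring.
  exact: (ler_wpM2l Bl0).
have H2 : B * l ^+ 2 * c ^+ 2 <= 64^-1 * (l * t).
  have -> : B * l ^+ 2 * c ^+ 2 = (B * l) * ((l * c) * c) by ring.
  have -> : 64^-1 * (l * t) = (B * l) * (mgf_range R * t) by rewrite -rB /B; ring.
  apply: (ler_wpM2l Bl0).
  exact: (ler_pM (mulr_ge0 l0 (ltW c0)) (ltW c0) lc ct).
lra.
Qed.

(** Markov's inequality with [E Z <= 4 E Zeps]. It serves for [t < c], where the rate to be reached
    is at most 1. *)
Lemma sup_Z_tail_small a t : 0 < a -> 0 < t ->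
  fine (nu [set x | a * z + t < Zs x]) <= 4 / a.
Proof.
move=> a0 t0.
have [okA <-] := indic_mean (measurable_exceed (a * z + t)).
have az : 0 < a * z + t by rewrite ltr_wpDl// mulr_ge0// ltW.
have H : (a * z + t) * tuple_mean nu (\1_[set x | a * z + t < Zs x]) <= 4 * z.
  apply: le_trans (symmetrization_mean nuE FF0 FFsym FFdiag FFbound FFmeas FFdeg mZ mZs).
  rewrite -(meanZ EP)//; apply: (mean_le EP) => // [|x]; first exact: (fcZ okP).
  rewrite indicE; case: (boolP (x \in _)); last by move=> _; rewrite mulr0; exact: Zs0.
  by rewrite inE/= mulr1 => /ltW.
rewrite -(ler_pM2l az); apply: (le_trans H).
have -> : (a * z + t) * (4 / a) = 4 * z + t * (4 / a) by field; rewrite gt_eqF.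
by rewrite lerDl mulr_ge0 ?divr_ge0// ltW.
Qed.

End concentration.

(** * Transfer to random variables *)

Section expectation_bounds.
Context {R : realType} {d : measure_display} {T : measurableType d}.
Variable P : probability T R.
Import HBNNSimple.

(** The integral of a nonnegative function is a supremum over simple functions below it, so
    monotonicity holds for arbitrary functions. This matters for suprema evaluated at [eps], whose
    measurability is known for fixed sign vectors only. *)
Lemma ge0_le_expectation (f g : T -> R) : (forall w, 0 <= f w) ->
  (forall w, f w <= g w) -> ('E_P[f] <= 'E_P[g])%E.
Proof.
move=> f0 fg; rewrite unlock !ge0_integralTE; last 2 first.
- by move=> w; rewrite lee_fin (le_trans (f0 w)).
- by move=> w; rewrite lee_fin.
apply: ereal_sup_le => _ [h hf <-].
exists h => // w; apply: (le_trans (hf w)); rewrite lee_fin; exact: fg.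
Qed.

Lemma expectation_comp {d' : measure_display} {T' : measurableType d'}
    (Y : {RV P >-> T'}) (g : T' -> R) : bounded_measurable g ->
  ('E_P[fun w => g (Y w)] = (\int[distribution P Y]_y g y)%R%:E)%E.
Proof.
move=> bg; rewrite unlock EFin_Rintegral// integral_distribution//.
  by apply/measurable_EFinP; case: bg.
apply: (@bounded_measurable_integrable _ _ _ P (g \o Y)).
have [mg [M gM]] := bg; split; last by exists M => w; exact: gM.
exact: measurableT_comp.
Qed.

End expectation_bounds.

Section random_vectors.
Context {R : realType} {d : measure_display} {T : measurableType d}.
Context {P : probability T R} {n : nat}.

Lemma measurable_random_vector {d' : measure_display} {T' : measurableType d'}
    (Y : 'I_n -> {RV P >-> T'}) : measurable_fun [set: T] (random_vector Y).
Proof.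
apply/measurable_fun_tnthP => i.
rewrite (_ : _ \o _ = Y i); first exact: measurable_funP.
by apply/funext => w /=; rewrite tnth_mktuple.
Qed.

Definition random_tuple {d' : measure_display} {T' : measurableType d'}
    (Y : 'I_n -> {RV P >-> T'}) : {RV P >-> n.-tuple T'} :=
  HB.pack (random_vector Y)
    (isMeasurableFun.Build _ _ _ _ _ (measurable_random_vector Y)).

Lemma random_tupleE {d' : measure_display} {T' : measurableType d'}
  (Y : 'I_n -> {RV P >-> T'}) w i : tnth (random_tuple Y w) i = Y i w.
Proof. by rewrite tnth_mktuple. Qed.

Lemma independent_rectangle {d' : measure_display} {T' : measurableType d'}
    (Y : 'I_n -> {RV P >-> T'}) (A : 'I_n -> set T') :
  mutually_independent Y -> (forall i, measurable (A i)) ->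
  distribution P (random_tuple Y) [set x | forall i, A i (tnth x i)] =
  (\prod_i P (Y i @^-1` A i))%E.
Proof.
move=> indY mA; have := indY [set: 'I_n]%SET _ mA.
rewrite big_mkcond/= => E; transitivity (P (\bigcap_(i in [set` [set: 'I_n]%SET]) (Y i @^-1` A i))).
  congr (P _); apply/seteqP; split => [w /= H i _|w /= H i].
    by have := H i; rewrite tnth_mktuple.
  by rewrite tnth_mktuple; apply: H; rewrite /= finset.in_setT.
by rewrite E; apply: eq_bigr => i _; rewrite finset.in_setT.
Qed.

(** [X] is the member [None] of the family and supplies the common law; the members [Some i] inherit
    independence through index sets that avoid [None]. *)
Lemma iid_sample_rectangle {d' : measure_display} {S : measurableType d'}
    (X : {RV P >-> S}) (Xs : 'I_n -> {RV P >-> S}) (A : 'I_n -> set S) :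
  iid (oapp Xs X) -> (forall i, measurable (A i)) ->
  distribution P (random_tuple Xs) [set x | forall i, A i (tnth x i)] =
  (\prod_i distribution P X (A i))%E.
Proof.
move=> [indX sameX] mA; rewrite independent_rectangle//.
  by apply: eq_bigr => i _; exact: (sameX (Some i) None).
move=> J B mB.
pose J' : {set option 'I_n} := [set Some i | i in J]%SET.
pose B' (o : option 'I_n) : set S := oapp B setT o.
have mB' o : measurable (B' o).
  by case: o => [i|]; [exact: mB|exact: measurableT].
have := indX J' B' mB'.
rewrite big_imset/=; last by move=> i j _ _ [].
move=> <-; congr (P _); apply/seteqP; split => [w H [i|] //=|w H i iJ].
  move=> iJ'; apply: H; move: iJ' => /= /imsetP[j jJ [->]]; exact: jJ.
by apply: (H (Some i)); rewrite /= imset_f.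
Qed.

Lemma rademacher_rectangle (e : 'I_n -> {RV P >-> R}) (b : {ffun 'I_n -> bool}) :
  iid e -> (forall i, rademacher (e i)) ->
  distribution P (random_tuple e) [set y | forall i, tnth y i = signs b i] =
  ((2 ^+ n)^-1)%:E.
Proof.
move=> [inde _] rade.
have := @independent_rectangle _ _ e (fun i => [set (signs b i : R)]) inde.
move=> -> //.
rewrite (eq_bigr (fun=> (2^-1)%:E)); last first.
  by move=> i _; rewrite /signs; have [p1 p2] := rade i; case: (b i).
by rewrite prodEFin prodr_const card_ord exprVn.
Qed.

Lemma independent_joint_law {d1 d2 : measure_display} {S1 : measurableType d1}
    {S2 : measurableType d2} (U : {RV P >-> S1}) (V : {RV P >-> S2})
    (UV : {RV P >-> (S1 * S2)%type}) (C : set (S1 * S2)) :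
  (forall w, UV w = (U w, V w)) -> independent_elements P U V -> measurable C ->
  distribution P UV C = (distribution P U \x distribution P V)%E C.
Proof.
move=> UVE ind mC; apply/esym.
apply: product_measure_unique => // A B mA mB.
rewrite -[RHS]/(P (U @^-1` A) * P (V @^-1` B))%E -ind//.
by congr (P _); apply/seteqP; split => w /=; rewrite UVE.
Qed.

End random_vectors.

Section sign_expectation.
Context {R : realType} {d dS : measure_display} {T : measurableType d}.
Context {S : measurableType dS} {P : probability T R} {n : nat}.
Variables (Xs : 'I_n -> {RV P >-> S}) (eps : 'I_n -> {RV P >-> R}).
Hypothesis iid_eps : iid eps.
Hypothesis rade_eps : forall i, rademacher (eps i).
Hypothesis indep : independent_elements P (random_vector eps) (random_vector Xs).

Let nu := distribution P (random_tuple Xs).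
Let rho := distribution P (random_tuple eps).

Let sign_set (b : {ffun 'I_n -> bool}) : set (n.-tuple R) :=
  [set y | forall i, tnth y i = signs b i].

Let measurable_sign_set b : measurable (sign_set b).
Proof. exact: (@measurable_tuple_rect _ R n (fun i => [set signs b i])). Qed.

Let signs_inj (b b' : {ffun 'I_n -> bool}) :
  (forall i, signs b i = signs b' i :> R) -> b = b'.
Proof.
move=> bb'; apply/ffunP => i; have := bb' i; rewrite /signs.
by case: (b i) (b' i) => [] []; rewrite ?expr0 ?expr1 => // H; exfalso; lra.
Qed.

Let pair : {RV P >-> (n.-tuple R * n.-tuple S)%type} :=
  HB.pack (fun w => (random_tuple eps w, random_tuple Xs w))
    (isMeasurableFun.Build _ _ _ _ _
      (measurable_fun_pair (measurable_funP (random_tuple eps))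
         (measurable_funP (random_tuple Xs)))).

Variable Phi : ('I_n -> R) -> ('I_n -> S) -> R.
Hypothesis Phi_ge0 : forall e x, 0 <= Phi e x.
Hypothesis okPhi : forall b : {ffun 'I_n -> bool},
  bounded_measurable (fun x : n.-tuple S => Phi (signs b) (tnth x)).

Let g (b : {ffun 'I_n -> bool}) (x : n.-tuple S) : R := Phi (signs b) (tnth x).

(** A measurable minorant of [Phi]: it equals [Phi] where [eps] is a sign vector, which is almost
    sure, and 0 elsewhere. *)
Let h (p : n.-tuple R * n.-tuple S) : R := \sum_b \1_(sign_set b) p.1 * g b p.2.

Let h_le w : h (pair w) <= Phi (fun i => eps i w) (fun i => Xs i w).
Proof.
rewrite /h /=; have [[b Db]|noD] := pselect (exists b, sign_set b (random_vector eps w)).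
  rewrite (bigD1 b)//= big1 ?addr0 => [|b' b'b].
    rewrite indicE mem_set// mul1r /g le_eqVlt; apply/orP; left; apply/eqP.
    congr (Phi _ _); apply/funext => i; last by rewrite tnth_mktuple.
    by rewrite -Db tnth_mktuple.
  rewrite indicE memNset ?mul0r// => Db'; move/eqP : b'b; apply.
  by apply: signs_inj => i; rewrite -Db -Db'.
rewrite big1// => b _; rewrite indicE memNset ?mul0r// => Db.
by apply: noD; exists b.
Qed.

Let ok_indic b : bounded_measurable (\1_(sign_set b) : n.-tuple R -> R).
Proof.
split; first exact: measurable_indic.
by exists 1 => x; rewrite indicE; case: (_ \in _); rewrite ?normr1 ?normr0.
Qed.

Let ok_comp {d1 d2 : measure_display} {T1 : measurableType d1}
    {T2 : measurableType d2} (f : T2 -> R) (phi : T1 -> T2) :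
  measurable_fun setT phi -> bounded_measurable f -> bounded_measurable (f \o phi).
Proof.
move=> mphi [mf [M fM]]; split; first exact: measurableT_comp.
by exists M => x; exact: fM.
Qed.

Let ok_h : bounded_measurable h.
Proof.
apply: (fc_sum (@bounded_measurable_class R _ _)) => b.
apply: (fcM (@bounded_measurable_class R _ _)).
- exact: (ok_comp measurable_fst (ok_indic b)).
- exact: (ok_comp measurable_snd (okPhi b)).
Qed.

(** The minorant [h] is integrated against the product of the laws of [eps] and of the sample, each
    sign pattern having weight [2^-n]. *)
Lemma joint_mean_le_expectation :
  ((joint_mean nu g)%:E <= 'E_P[fun w => Phi (fun i => eps i w) (fun i => Xs i w)])%E.
Proof.
have h0 p : 0 <= h p.
  by apply: sumr_ge0 => b _; apply: mulr_ge0; [rewrite indicE|exact: Phi_ge0].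
apply: le_trans (ge0_le_expectation P (fun w => h0 (pair w)) h_le).
rewrite expectation_comp// [X in (_ <= X)%E]EFin_Rintegral//.
rewrite (eq_measure_integral (rho \x nu)%E); last first.
  by move=> A mA _; exact: independent_joint_law.
rewrite fubini_tonelli1; last 2 first.
- by apply/measurable_EFinP; case: ok_h.
- by move=> p; rewrite lee_fin.
have Mnu := Rintegral_mean nu; have Mrho := Rintegral_mean rho.
have Cnu := @bounded_measurable_class R _ (n.-tuple S).
have Crho := @bounded_measurable_class R _ (n.-tuple R).
have -> : (\int[rho]_y fubini_F nu (fun p => (h p)%:E) y)%E =
    (\int[rho]_y (\sum_b tuple_mean nu (g b) * \1_(sign_set b) y)%:E)%E.
  apply: eq_integral => y _; rewrite /fubini_F -EFin_Rintegral; last first.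
    apply: (fc_sum Cnu) => b /=; exact: (fcZ Cnu _ (okPhi b)).
  congr (_%:E); rewrite /h /= (mean_sum Cnu Mnu); last first.
    by move=> b; exact: (fcZ Cnu _ (okPhi b)).
  by apply: eq_bigr => b _; rewrite [RHS]mulrC; exact: (meanZ Mnu _ (okPhi b)).
have okc b : bounded_measurable (fun y => tuple_mean nu (g b) * \1_(sign_set b) y).
  exact: (fcZ Crho _ (ok_indic b)).
rewrite -EFin_Rintegral; last exact: (fc_sum Crho).
rewrite lee_fin (mean_sum Crho Mrho)// le_eqVlt; apply/orP; left; apply/eqP.
rewrite /joint_mean /cube_mean /tuple_mean (meanZ Mnu); last exact: (fc_sum Cnu).
rewrite (mean_sum Cnu Mnu)// mulr_sumr; apply: eq_bigr => b _.
rewrite (meanZ Mrho)// mulrC; congr (_ * _).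
rewrite /Rintegral integral_indic// setIT.
by rewrite [X in fine X](rademacher_rectangle b iid_eps rade_eps)/= card_ord.
Qed.

End sign_expectation.

(** On a set without supremum [sup] returns 0, so neither boundedness for arbitrary real signs nor
    nonemptiness has to be checked. *)
Lemma nonneg_sup_ge0 {R : realType} (A : set R) : (forall x, A x -> 0 <= x) -> 0 <= sup A.
Proof.
move=> A0; have [[[x Ax] ubA]|/sup_out -> //] := pselect (has_sup A).
by apply: le_trans (A0 x Ax) _; exact: ub_le_sup.
Qed.

Section kernel_class.
Context {R : realType} {S : Type}.
Variables (FF : set (S -> S -> R)) (F : R).
Hypothesis FFsup : ereal_sup [set supnorm f | f in FF] = F%:E.

Lemma kernel_class_nonempty : FF !=set0.
Proof.
apply/set0P/eqP => FF0; move: FFsup.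
by rewrite FF0 image_set0 ereal_sup0.
Qed.

Lemma kernel_class_bound f : FF f -> forall x y, `|f x y| <= F.
Proof.
move=> Ff x y; rewrite -lee_fin -FFsup.
apply: le_trans (_ : supnorm f <= _)%E.
  by apply: ereal_sup_ubound; exists (x, y).
by apply: ereal_sup_ubound; exists f.
Qed.

End kernel_class.

(** * The minimum of the rates in the extended reals *)

Section ereal_minimum.
Context {R : realType}.
Local Open Scope ereal_scope.

(** [c <= em + c] and [u <= eu] turn the entries with these denominators into real bounds on the
    minimum. It is finite, being at most [t / c]; an infinite [eu] makes it 0, and [eu = 0] forces
    [u = 0]. *)
Lemma mine4_bound (t c u : R) (eu em y z : \bar R) :
  (0 < t)%R -> (0 < c)%R -> (0 <= u)%R -> u%:E <= eu -> 0 <= em ->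
  0 <= y -> 0 <= z ->
  exists r : R, [/\ (0 <= r)%R, (r * c <= t)%R, (r * u ^+ 2 <= t ^+ 2)%R &
   mine (mine ((t%:E / eu) ^+ 2) (t%:E / (em + c%:E))) (mine y z) = r%:E].
Proof.
move=> t0 c0 u0 ueu em0 y0 z0.
set a := (t%:E / eu) ^+ 2; set b := t%:E / (em + c%:E).
have eu0 : 0 <= eu by apply: le_trans ueu; rewrite lee_fin.
have a0 : 0 <= a.
  by rewrite /a expe2 mule_ge0// mule_ge0 ?inve_ge0// lee_fin ltW.
have b0 : 0 <= b.
  by rewrite /b mule_ge0 ?inve_ge0 ?adde_ge0// lee_fin ltW.
have btc : b <= (t / c)%:E.
  rewrite /b {b b0}; case: em em0 => [v| |]//= v0.
    rewrite lee_fin in v0; rewrite -EFinD inver gt_eqF ?ltr_wpDl// -EFinM lee_fin.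
    by rewrite ler_pM2l// lef_pV2 ?posrE ?ltr_wpDl// lerDr.
  by rewrite invey mule0 lee_fin divr_ge0// ltW.
set m := mine _ _.
have m0 : 0 <= m by rewrite /m !le_min a0 b0 y0 z0.
have mb : m <= b by rewrite /m !ge_min lexx ?orbT.
have ma : m <= a by rewrite /m !ge_min lexx ?orbT.
have mfin : m \is a fin_num.
  rewrite ge0_fin_numE//; apply: le_lt_trans (ltry (t / c)).
  exact: le_trans btc.
exists (fine m); rewrite fineK//; split => //; first exact: fine_ge0.
  by rewrite -ler_pdivlMr// -lee_fin fineK//; exact: le_trans btc.
have {ma} : (fine m)%:E <= a by rewrite fineK.
have : (0 <= fine m)%R by exact: fine_ge0.
move: (fine m) => r r0; rewrite /a; clear mfin mb m0 m.
case: eu ueu eu0 {a0 a} => [v| |]//.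
  rewrite !lee_fin => uv v0.
  have [vz|vn] := eqVneq v 0%R.
    have -> : u = 0%R by apply/eqP; rewrite eq_le u0 andbT -vz.
    by move=> _; rewrite expr0n/= mulr0 sqr_ge0.
  have vp : (0 < v)%R by rewrite lt_neqAle eq_sym vn.
  rewrite inver (negbTE vn) -EFinM -EFin_expe lee_fin => rv.
  apply: (@le_trans _ _ (r * v ^+ 2)%R).
    by rewrite ler_wpM2l// lerXn2r ?nnegrE.
  by rewrite -ler_pdivlMr ?exprn_gt0// -exprVn -exprMn.
move=> _ _; rewrite invey mule0 expe2 mule0 lee_fin => r00.
have -> : r = 0%R by apply/eqP; rewrite eq_le r0 r00.
by rewrite mul0r sqr_ge0.
Qed.

End ereal_minimum.

(** The constant sign vector 1 turns [sup_Z] into a supremum of chaoses. The bound settles the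
    degenerate case [F n = 0], where [Z] vanishes. *)
Lemma sup_Z_le {R : realType} {S : Type} {n : nat} (FF : set (S -> S -> R)) (F : R)
    (x : 'I_n -> S) : FF !=set0 ->
  (forall f, FF f -> forall x y, f x y = f y x) ->
  (forall f, FF f -> forall x, f x x = 0) ->
  (forall f, FF f -> forall x y, `|f x y| <= F) ->
  sup_Z FF x <= F * n%:R * n%:R.
Proof.
move=> FF0 FFsym FFdiag FFbound; apply: image_sup_le => // f Ff.
have one : @sign_vector R n (fun=> 1) by move=> i /=; rewrite normr1.
have := norm_chaos_le (kernel_atP FFsym FFdiag FFbound x Ff) one.
rewrite /chaos /kernel_at.
rewrite (eq_bigr (fun i => \sum_j f (x i) (x j)))// => i _.
by apply: eq_bigr => j _; rewrite !mul1r.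
Qed.

(** [C = C1 + 128 B] dominates the moment constant [C1] and gives [1 / C <= 1 / (128 B)], half of
    [mgf_range]. *)
Lemma concentration_constant (R : realType) : exists C : R,
  [/\ 16 <= C, 0 <= 1024 * expR (moment_cst R),
      1024 * expR (moment_cst R) <= C, 0 < mgf_range R & C^-1 <= mgf_range R / 2].
Proof.
have B1 := mgf_cst_ge R; have eA := expR_ge0 (moment_cst R).
have C10 : 0 <= 1024 * expR (moment_cst R) by apply: mulr_ge0; [lra|].
rewrite /mgf_range; move: (mgf_cst R) (1024 * expR (moment_cst R)) B1 C10 => B C1 B1 C10.
have B0 : 0 < B by lra.
exists (C1 + 128 * B); split => //; try lra.
  by rewrite invr_gt0 mulr_gt0.
have -> : (64 * B)^-1 / 2 = (128 * B)^-1 by field; rewrite gt_eqF.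
by rewrite lef_pV2 ?posrE; lra.
Qed.

Theorem theorem11 (R : realType) :
  exists C : R, 0 < C /\
  forall (d dS : measure_display) (T : measurableType d)
    (S : measurableType dS) (P : probability T R) (n : nat)
    (X : {RV P >-> S}) (Xs : 'I_n -> {RV P >-> S})
    (eps : 'I_n -> {RV P >-> R})
    (FF : set (S -> S -> R)) (F : R),
  (* X, X_1, ..., X_n are i.i.d. *)
  iid (oapp Xs X) ->
  (forall f, FF f ->
    measurable_fun [set: S * S] (fun xy : S * S => f xy.1 xy.2)) ->
  (forall f, FF f -> forall x y, f x y = f y x) ->
  (forall f, FF f -> forall x, ('E_P[fun w => f (X w) x] = 0)%E) ->
  (forall f, FF f -> forall x, f x x = 0) ->
  ereal_sup [set supnorm f | f in FF] = F%:E ->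
  iid eps ->
  (forall i, rademacher (eps i)) ->
  independent_elements P (random_vector eps) (random_vector Xs) ->
  measurable_suprema n FF ->
  let Z := fun w => sup_Z FF (fun i => Xs i w) in
  let Zeps := fun w => sup_Zeps FF (fun i => eps i w) (fun i => Xs i w) in
  let Ueps := fun w => sup_Ueps FF (fun i => eps i w) (fun i => Xs i w) in
  let M := fun w => sup_M FF (fun i => eps i w) (fun i => Xs i w) in
  (forall q : R, 2 <= q ->
    ('E_P[fun w => (Z w `^ q)%R] `^ q^-1 <=
     C%:E * ('E_P[Zeps] + (Num.sqrt q)%:E * 'E_P[Ueps]
             + q%:E * ('E_P[M] + (F * n%:R)%:E)
             + (q `^ (3 / 2) * F * Num.sqrt n%:R)%:E
             + (q ^+ 2 * F)%:E))%E) /\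
  (forall t : R, 0 < t ->
    (P [set w | C%:E * 'E_P[Zeps] + t%:E < (Z w)%:E] <=
     expeR (- ((C^-1)%:E *
       mine (mine ((t%:E / 'E_P[Ueps]) ^+ 2)
                  (t%:E / ('E_P[M] + (F * n%:R)%:E)))
            (mine ((t%:E / (F * Num.sqrt n%:R)%:E) `^ (2 / 3))
                  ((t%:E / F%:E) `^ 2^-1)))))%E).
Proof.
have [C [C16 C10 C1C r0 rC]] := concentration_constant R.
move: (1024 * expR (moment_cst R)) (@sup_Z_moment R) C10 C1C => C1 moment C10 C1C.
move: (mgf_range R) (@sup_Z_tail R) r0 rC => range tail r0 rC.
have C0 : 0 < C by exact: lt_le_trans C16.
exists C; split=> // d dS T S P n X Xs eps FF F iidX FFmeas FFsym deg FFdiag FFsup iid_eps rade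
  indep [mZs mE] Z Zeps Ueps M.
have FF0 := kernel_class_nonempty FFsup.
have FFbound := kernel_class_bound FFsup.
pose mu : probability S R := distribution P X.
pose nu : probability (n.-tuple S) R := distribution P (random_tuple Xs).
have nuE A : (forall i, measurable (A i)) ->
    nu [set x | forall i, A i (tnth x i)] = (\prod_i mu (A i))%E.
  exact: iid_sample_rectangle.
have sgn (b : {ffun 'I_n -> bool}) i : signs b i = 1 :> R \/ signs b i = -1 :> R.
  by rewrite /signs; case: (b i); [right|left].
pose Zb (b : {ffun 'I_n -> bool}) (x : n.-tuple S) : R := sup_Zeps FF (signs b) (tnth x).
pose Ub (b : {ffun 'I_n -> bool}) (x : n.-tuple S) : R := sup_Ueps FF (signs b) (tnth x).
pose Zs (x : n.-tuple S) : R := sup_Z FF (tnth x).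
have mZ b : measurable_fun [set: n.-tuple S] (Zb b) by case: (mE _ (sgn b)).
have mU b : measurable_fun [set: n.-tuple S] (Ub b) by case: (mE _ (sgn b)).
have FFdeg f : FF f -> forall y, \int[mu]_s f s y = 0.
  move=> Ff y.
  have bf : bounded_measurable (fun s => f s y).
    split; last by exists F => s; exact: FFbound.
    have mp : measurable_fun [set: S] (fun s : S => (s, y)).
      by apply: measurable_fun_pair => //; exact: measurable_cst.
    exact: (measurableT_comp (FFmeas f Ff) mp).
  have := deg f Ff y; rewrite (expectation_comp X bf) => -[].
  exact.
have XsE w : tnth (random_tuple Xs w) = fun i => Xs i w.
  by apply/funext => i; rewrite random_tupleE.
pose z := joint_mean nu Zb; pose u := joint_mean nu Ub.
have zE : (z%:E <= 'E_P[Zeps])%E.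
  apply: (joint_mean_le_expectation iid_eps rade indep (Phi := sup_Zeps FF)).
    by move=> e x; apply: nonneg_sup_ge0 => _ [f Ff <-].
  by move=> b; exact: (bounded_measurable_sup_Zeps FF0 FFsym FFdiag FFbound (mZ b)).
have uE : (u%:E <= 'E_P[Ueps])%E.
  apply: (joint_mean_le_expectation iid_eps rade indep (Phi := sup_Ueps FF)).
    move=> e x; rewrite sup_UepsE; apply: nonneg_sup_ge0 => _ [f Ff <-].
    exact: sqrtr_ge0.
  by move=> b; exact: (bounded_measurable_sup_Ueps FF0 FFsym FFdiag FFbound (mU b)).
have ME : (0 <= 'E_P[M])%E.
  apply: expectation_ge0 => w; apply: nonneg_sup_ge0 => _ [f Ff [k _ <-]].
  exact: normr_ge0.
have z0 : 0 <= z := sup_Zeps_mean_ge0 nu FF0 FFsym FFdiag FFbound mZ.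
have u0 : 0 <= u := sup_Ueps_mean_ge0 nu FF0 FFsym FFdiag FFbound mU.
have ZE : Z = fun w => Zs (random_tuple Xs w).
  by apply/funext => w; rewrite /Zs XsE.
have Zs0 x : 0 <= Zs x by apply: nonneg_sup_ge0 => _ [f Ff <-].
have okZs : bounded_measurable Zs :=
  ok_sup_Z nuE FF0 FFsym FFdiag FFbound FFmeas FFdeg mZ mZs.
have F0 : 0 <= F.
  have [f Ff] := FF0; have s : S by exact: point.
  exact: le_trans (FFbound f Ff s s).
have c0 : 0 <= F * n%:R by exact: mulr_ge0.
split=> [q q2|t t0].
  have q0 : 0 < q by lra.
  have okp := bounded_measurable_powR okZs Zs0 (ltW q0).
  have -> : ('E_P[fun w => (Z w `^ q)%R] = (tuple_mean nu (fun x => Zs x `^ q)%R)%:E)%E.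
    by rewrite ZE (expectation_comp (random_tuple Xs) okp).
  rewrite poweR_EFin.
  apply: (@le_trans _ _ (C1 * (z + Num.sqrt q * u + q * (F * n%:R)))%:E).
    rewrite lee_fin.
    have D0 : 0 <= C1 * (z + Num.sqrt q * u + q * (F * n%:R)).
      by rewrite mulr_ge0// !addr_ge0// mulr_ge0// ?sqrtr_ge0// ltW.
    have [cp|cn] := ltP 0 (F * n%:R); last first.
      have Zs_eq0 x : Zs x = 0.
        apply/eqP; rewrite eq_le Zs0 andbT.
        apply: (le_trans (sup_Z_le (tnth x) FF0 FFsym FFdiag FFbound)).
        by rewrite mulr_le0_ge0.
      have -> : tuple_mean nu (fun x => Zs x `^ q) = 0.
        apply: (mean_cst_fun (Rintegral_mean nu)) => x.
        by rewrite Zs_eq0 powR0// gt_eqF.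
      by rewrite powR0// invr_eq0 gt_eqF.
    have q1 : 1 <= q by lra.
    have := moment _ _ _ _ _ nuE _ _ FF0 FFsym FFdiag FFbound FFmeas FFdeg mZ mU mZs _ cp q1.
    rewrite -/z -/u => H.
    apply: (@le_trans _ _ (((C1 * (z + Num.sqrt q * u + q * (F * n%:R))) `^ q) `^ q^-1)).
      apply: ge0_ler_powR; rewrite ?nnegrE ?invr_ge0 ?(ltW q0) ?powR_ge0//.
      apply: (mean_ge0 (@bounded_measurable_class R _ _) (Rintegral_mean nu)) => // x.
      exact: powR_ge0.
    by rewrite -powRrM divff ?gt_eqF// powRr1.
  apply: (@le_trans _ _ (C%:E * (z + Num.sqrt q * u + q * (F * n%:R))%:E)%E).
    rewrite -EFinM lee_fin ler_wpM2r// !addr_ge0// mulr_ge0// ?sqrtr_ge0//.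
    exact: ltW.
  apply: lee_wpmul2l; first by rewrite lee_fin ltW.
  have sq0 : (0 <= (Num.sqrt q)%:E)%E by rewrite lee_fin sqrtr_ge0.
  have qE0 : (0 <= q%:E)%E by rewrite lee_fin ltW.
  have main : ((z + Num.sqrt q * u + q * (F * n%:R))%:E <=
      'E_P[Zeps] + (Num.sqrt q)%:E * 'E_P[Ueps] + q%:E * ('E_P[M] + (F * n%:R)%:E))%E.
    rewrite !EFinD !EFinM; apply: leeD.
      by apply: leeD => //; exact: lee_wpmul2l.
    by apply: lee_wpmul2l => //; rewrite -EFinM leeDr.
  have p1 : (0 <= (q `^ (3 / 2) * F * Num.sqrt n%:R)%:E)%E.
    by rewrite lee_fin mulr_ge0 ?sqrtr_ge0// mulr_ge0 ?powR_ge0.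
  have p2 : (0 <= (q ^+ 2 * F)%:E)%E by rewrite lee_fin mulr_ge0 ?sqr_ge0.
  exact: (le_trans main (le_trans (leeDl _ p1) (leeDl _ p2))).
have okA a : measurable [set x | a < Zs x].
  rewrite -[X in measurable X]setTI.
  have -> : [set x | a < Zs x] = Zs @^-1` `]a, +oo[%classic.
    by apply/seteqP; split=> x /=; rewrite in_itv/= andbT.
  exact: mZs.
apply: (@le_trans _ _ (nu [set x | C * z + t < Zs x])).
  (* An infinite expectation makes the threshold infinite and the event empty. *)
  case: ('E_P[Zeps])%E zE => [v| |] //.
    rewrite lee_fin => zv.
    apply: (@le_trans _ _ (nu [set x | C * v + t < Zs x])).
      rewrite le_eqVlt; apply/orP; left; apply/eqP; congr (P _).
      by apply/seteqP; split => w /=; rewrite -EFinM -EFinD lte_fin ZE.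
    apply: le_measure; rewrite ?inE; [exact: okA..|].
    by move=> x /=; apply: le_lt_trans; rewrite lerD2r ler_pM2l.
  move=> _; rewrite [X in P X](_ : _ = set0) ?measure0//.
  by apply/seteqP; split => w //=; rewrite gt0_muley// lte_fin.
have nu_fin A : measurable A -> (fine (nu A))%:E = nu A.
  by move=> mA; rewrite fineK// fin_num_measure.
have [cp|cn] := ltP 0 (F * n%:R); last first.
  have -> : [set x | C * z + t < Zs x] = set0.
    apply/seteqP; split => x //=; apply/negP; rewrite -leNgt.
    apply: (le_trans (sup_Z_le (tnth x) FF0 FFsym FFdiag FFbound)).
    apply: (@le_trans _ _ 0); first by rewrite mulr_le0_ge0.
    by rewrite addr_ge0 ?mulr_ge0 ?(ltW C0) ?(ltW t0).
  have nu0 : (nu set0 <= 0)%E by rewrite measure0.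
  exact: (le_trans nu0 (expeR_ge0 _)).
have [r [rr0 rc ru ->]] := mine4_bound t0 cp u0 uE ME
  (poweR_ge0 (t%:E / (F * Num.sqrt n%:R)%:E)%E (2 / 3))
  (poweR_ge0 (t%:E / F%:E)%E 2^-1).
rewrite -(nu_fin _ (okA _)) -EFinM -EFinN lee_fin.
have [ct|tc] := leP (F * n%:R) t.
  (* For this [l], [r c <= t] and [r u^2 <= t^2] are exactly the two constraints of [tail], and
     [l t / 2 = (range / 2) r >= r / C]. *)
  pose l := range * r / t.
  have l0 : 0 <= l by rewrite divr_ge0 ?mulr_ge0 ?(ltW r0) ?(ltW t0).
  apply: (le_trans (tail _ _ _ _ _ nuE _ _ FF0 FFsym FFdiag FFbound FFmeas FFdeg
    mZ mU mZs _ _ l C16 cp ct l0 _ _)).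
  - rewrite /l mulrAC ler_pdivrMr// -!mulrA ler_pM2l//.
  - rewrite /l mulrAC ler_pdivrMr// -!mulrA ler_pM2l//.
  rewrite ler_expR lerN2.
  have -> : l * t / 2 = range / 2 * r by rewrite /l; field; rewrite gt_eqF.
  by rewrite ler_wpM2r.
(* Here [t < F n], so [r <= 1] and the bound to reach is at least [exp (-1) >= 1/4 >= 4 / C]. *)
apply: (le_trans (sup_Z_tail_small nuE FF0 FFsym FFdiag FFbound FFmeas FFdeg mZ mZs C0 t0)).
have r1 : r <= 1.
  rewrite -(ler_pM2r cp) mul1r; apply: (le_trans rc); exact: ltW.
apply: (@le_trans _ _ (expR (- 1))); last first.
  rewrite ler_expR lerN2 mulrC ler_pdivrMr// mul1r; lra.
apply: (@le_trans _ _ 4^-1).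
  rewrite ler_pdivrMr//; lra.
have -> : -1 = - 2^-1 + - 2^-1 :> R by lra.
by rewrite expRD; have := expR_ge1Dx (- 2^-1 : R); nra.
Qed.
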